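(* Fix an integer $m\geq 1$ and $p\in(0,1)$, and put $q=1-p$. Let $\mathbf{x}=(x_1,x_2,\ldots)$ be indeterminates. Then, as formal power series in $u$ (with coefficients polynomials in the $x_i$), $$1+\sum_{n\ge 1}u^n\sum_{\pi\in S_n}\nu^{(p)}_{n,m}(\pi)X(\pi;\mathbf{x})=\prod_{i\ge 1}\exp\left\{\sum_{r\ge 1}\frac{B^{(m,p)}_{i,r}}{ir}\,x_i^r u^{ir}\right\},$$ where, for $i,r\geq 1$, $$B^{(m,p)}_{i,r}:=\sum_{d\mid i}\mu(d)\, m^{\,i/d-ir}\bigl(p^{dr}-(-q)^{dr}\bigr)^{i/d}.$$
   Context: Asymmetric shelf shuffle: let $m\ge 1$ be an integer, $p\in(0,1)$, $q=1-p$. A deck of $n$ cards labelled $1,\ldots,n$ from top to bottom is dealt sequentially from the bottom (card $n$ first, card $1$ last). Each card is assigned to one of $m$ labelled shelves independently and uniformly at random, and is placed at the top of the existing pile on that shelf with probability $p$ and at the bottom with probability $q$, independently of everything else. The shuffled deck is formed by joining the piles in shelf order (shelf $1$ on top, then shelf $2$, and so on). The resulting random permutation is $\pi=(\pi_1,\ldots,\pi_n)\in S_n$, where $\pi_i$ is the label of the card in position $i$ from the top, and $\nu^{(p)}_{n,m}$ denotes its law on $S_n$. For $\pi\in S_n$, $N_i(\pi)$ is the number of cycles of length $i$ of $\pi$, and $X(\pi;\mathbf{x}):=\prod_{i\ge1}x_i^{N_i(\pi)}$. $\mu$ is the number-theoretic Möbius function. *)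

(* Defs.v *)
From HB Require Import structures.
From mathcomp Require Import all_boot all_order all_fingroup all_algebra.
From mathcomp Require Import finmap.
From mathcomp Require Import reals.
From mathcomp Require Export monalg.

Set Implicit Arguments.
Unset Strict Implicit.
Unset Printing Implicit Defensive.

Import GRing.Theory Num.Theory.
Local Open Scope ring_scope.

(* Formal power series in [u]: [f n] is the coefficient of [u ^ n]. *)
Definition fps (A : Type) : Type := nat -> A.

Definition fps_one (A : nzRingType) : fps A := fun n => (n == 0%N)%:R.

Definition fps_mul (A : nzRingType) (f g : fps A) : fps A :=
  fun n => \sum_(k < n.+1) f k * g (n - k)%N.

Definition fps_pow (A : nzRingType) (f : fps A) (k : nat) : fps A :=
  iter k (fps_mul f) (fps_one A).

Definition fps_mono (A : nzRingType) (a : A) (k : nat) : fps A :=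
  fun n => if n == k then a else 0.

(* Convergence in the u-adic topology: each coefficient is eventually
   constant. *)
Definition fps_cvg (A : Type) (F : nat -> fps A) (f : fps A) : Prop :=
  forall n, exists N0, forall N, (N0 <= N)%N -> F N n = f n.

(* The infinite sum of [G k] over k >= 1, where [G k] must be divisible by
   [u ^ k]: truncating at k <= n then loses nothing, see [fps_sum_cvg]. *)
Definition fps_sum (A : nzRingType) (G : nat -> fps A) : fps A :=
  fun n => \sum_(1 <= k < n.+1) G k n.

Lemma fps_sum_cvg (A : nzRingType) (G : nat -> fps A) :
  (forall k n, (n < k)%N -> G k n = 0) ->
  fps_cvg (fun N n => \sum_(1 <= k < N.+1) G k n) (fps_sum G).
Proof.
move=> G0 n; exists n => N leN.
rewrite (@big_cat_nat _ _ _ n.+1) //= [X in _ + X]big_nat_cond [X in _ + X]big1 ?addr0 //.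
by move=> k; rewrite andbT => /andP[/G0 ->].
Qed.

(* Meaningful for [f] without constant term, so that [f ^ k] is divisible by
   [u ^ k], see [fps_pow_lt]. *)
Definition fps_exp (R : fieldType) (A : algType R) (f : fps A) : fps A :=
  fun n => fps_one A n
           + fps_sum (fun k j => (k`!%:R : R)^-1 *: fps_pow f k j) n.

Lemma fps_pow_lt (A : nzRingType) (f : fps A) :
  f 0%N = 0 -> forall k n, (n < k)%N -> fps_pow f k n = 0.
Proof.
move=> f0; elim=> // k IHk n; rewrite ltnS => le_nk /=.
rewrite /fps_mul big1 // => -[[|j] ltj] _ /=; first by rewrite f0 mul0r.
by rewrite [X in _ * X]IHk ?mulr0 // ltn_subLR // (leq_ltn_trans le_nk) ?ltnS ?leq_addl.
Qed.

(* The product of [F i] over i >= 1 converges to [g]. *)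
Definition fps_prod_eq (A : nzRingType) (F : nat -> fps A) (g : fps A) : Prop :=
  fps_cvg (fun N => \big[@fps_mul A/fps_one A]_(1 <= i < N.+1) F i) g.

(* Card [c : 'I_n] carries the label c + 1, and position [i : 'I_n] is the
   (i + 1)-st from the top; piles and decks are listed from top to bottom.
   For each card, an outcome records its shelf and whether it is put on the
   top ([true]) or at the bottom ([false]) of the pile on that shelf. *)
Definition outcome (n m : nat) : finType := {ffun 'I_n -> 'I_m * bool}.

Definition deal_card (n m : nat) (w : outcome n m)
    (piles : 'I_m -> seq 'I_n) (c : 'I_n) : 'I_m -> seq 'I_n :=
  fun s => if s == (w c).1
           then (if (w c).2 then c :: piles s else rcons (piles s) c)
           else piles s.

Definition deal (n m : nat) (w : outcome n m) : 'I_m -> seq 'I_n :=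
  foldl (deal_card w) (fun _ => [::]) (rev (enum 'I_n)).

Definition deck (n m : nat) (w : outcome n m) : seq 'I_n :=
  flatten [seq deal w s | s <- enum 'I_m].

Definition outcome_prob (R : fieldType) (n m : nat) (p : R)
    (w : outcome n m) : R :=
  \prod_(c < n) (m%:R^-1 * (if (w c).2 then p else 1 - p)).

Definition nu (R : fieldType) (n m : nat) (p : R) (pi : 'S_n) : R :=
  \sum_(w : outcome n m | deck w == [seq pi i | i <- enum 'I_n])
     outcome_prob p w.

Definition ncycles (n : nat) (i : nat) (pi : 'S_n) : nat :=
  #|[set C in porbits pi | #|C| == i]|.

(* Polynomials over [R] in countably many commuting indeterminates. *)
Notation xpoly R := {malg R[{cmonom nat}]}.

Definition xvar (R : realType) (i : nat) : xpoly R := << ucm i >>.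

(* A permutation of n points has no cycle of length i > n. *)
Definition cycle_monomial (R : realType) (n : nat) (pi : 'S_n) : xpoly R :=
  \prod_(1 <= i < n.+1) xvar R i ^+ ncycles i pi.

Definition cycle_genfun (R : realType) (m : nat) (p : R) : fps (xpoly R) :=
  fun n => if n == 0%N then 1
           else \sum_(pi : 'S_n) nu m p pi *: cycle_monomial R pi.

Definition moebius (d : nat) : int :=
  if all (fun l => logn l d == 1%N) (primes d) then (-1) ^+ size (primes d)
  else 0.

Definition Bcoef (R : fieldType) (m : nat) (p : R) (i r : nat) : R :=
  let q := 1 - p in
  \sum_(d <- divisors i)
    (moebius d)%:~R * (m%:R : R) ^ ((i %/ d)%:Z - (i * r)%:Z)
    * (p ^+ (d * r) - (- q) ^+ (d * r)) ^+ (i %/ d).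

Definition log_factor (R : realType) (m : nat) (p : R) (i : nat) :
    fps (xpoly R) :=
  fps_sum (fun r => fps_mono ((Bcoef m p i r / (i * r)%:R) *: xvar R i ^+ r)
                             (i * r)%N).

(* Main.v *)
Require Import Defs.
From mathcomp Require Import all_boot all_order all_fingroup all_algebra.
From mathcomp Require Import reals zify ring.
Set Implicit Arguments.
Unset Strict Implicit.
Unset Printing Implicit Defensive.
Import GRing.Theory Num.Theory.
Local Open Scope ring_scope.

(** Call a pair (shelf, top or bottom) a letter, positive for top and negative
for bottom, and order the letters by shelf, top before bottom.  Since the cards
are dealt from the bottom of the deck, the cards of a positive letter end up in
increasing order and those of a negative letter in decreasing order: the
shuffled deck s is the word w of letters sorted, with ties broken according to
sign ([sorts_shelf_perm]).

The cycle type of s comes from a signed version of the Gessel-Reutenauer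
bijection.  The itinerary of card c is the periodic sequence of letters
w (s c), w (s (s c)), and so on.  Itineraries increase with c for the
lexicographic order in which every negative letter read reverses the comparison
of what follows ([sle_itinerary]).  Hence the word can be recovered from the
multiset of its itineraries ([mult_inj]), and every shift-invariant multiset of
n periodic sequences arises ([mult_surj]).  Such a multiset is a choice of a
multiplicity k for each shift orbit.  An orbit of size d and weight c whose
letters have a positive product of signs carries k cycles of length d; if the
product is negative, going once around the orbit reverses the order of the k
cards with a given itinerary, so that they are matched in pairs, with one card
in the middle left alone if k is odd: there are k / 2 cycles of length 2 d and,
for k odd, one of length d ([count_order], [cycle_product_orbits]).  The
generating function is therefore the product over the orbits of
1 / (1 - c x_d u^d), respectively
(1 + c x_d u^d) / (1 - c^2 x_(2 d) u^(2 d)) ([word_sum]).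

Both sides of the theorem have constant term 1, so it suffices to compare their
logarithmic derivatives ([logder_inj]).  For the product over the orbits, the
coefficient of x_i^r u^(i r) is a signed sum D(i, r) over the periodic sequences
of period i, and of period i / 2 with negative sign ([orbit_power_sum]).
Sorting the words of length i by their period gives
S_r^i = sum of D(i / d, d r) over the divisors d of i, where S_r is the signed
sum of the r-th powers of the weights of the letters ([power_sum_orbits]), and
Moebius inversion turns this into the formula that defines the coefficients
B(i, r) ([orbit_power_sum_Bcoef]). *)

(** * Logarithmic derivatives of power series *)

Section LogarithmicDerivative.

Variables (R : numFieldType) (A : comAlgType R).
Implicit Types (f g : fps A) (p q : {poly A}).

(** [g] is u f' / f; multiplying by [f] avoids the division. *)
Definition logder f g :=
  [/\ f 0%N = 1, g 0%N = 0 & forall n, f n *+ n = fps_mul g f n].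

(** Below any given degree series are polynomials, for which the ring laws and
the rules for derivatives are available. *)
Definition agree N f p := forall i, (i < N)%N -> p`_i = f i.

Definition trunc N f : {poly A} := \poly_(i < N) f i.

Lemma trunc_agree f N : agree N f (trunc N f).
Proof. by move=> i ltiN; rewrite coef_poly ltiN. Qed.

Lemma agree_mul N f g p q :
  agree N f p -> agree N g q -> agree N (fps_mul f g) (p * q).
Proof.
move=> fp gq i ltiN; rewrite coefM; apply: eq_bigr => j _.
have := ltn_ord j; rewrite ltnS => lej.
by rewrite fp ?gq //; lia.
Qed.

Lemma agree_one N : agree N (fps_one A) 1.
Proof. by move=> i _; rewrite coef1. Qed.

Lemma agree_pow N f p k : agree N f p -> agree N (fps_pow f k) (p ^+ k).
Proof.
move=> fp; elim: k => [|k IHk]; first by rewrite expr0; exact: agree_one.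
by rewrite exprS; exact: agree_mul.
Qed.

Lemma agree_deriv N f p :
  agree N f p -> agree N (fun i => f i *+ i) ('X * p^`()).
Proof.
by move=> fp [|i] ltiN; rewrite coefXM //= coef_deriv fp.
Qed.

Lemma agree_coef_mul N p1 p2 q i :
  (i < N)%N -> (forall j, (j < N)%N -> p1`_j = p2`_j) ->
  (p1 * q)`_i = (p2 * q)`_i.
Proof.
move=> ltiN eqp; rewrite !coefM; apply: eq_bigr => j _.
have := ltn_ord j; rewrite ltnS => lej.
by rewrite eqp //; lia.
Qed.

Lemma logder_one : logder (fps_one A) (fun=> 0).
Proof.
split=> // -[|n]; rewrite /fps_mul ?mulr0n ?mul0rn;
  by rewrite big1 // => *; rewrite mul0r.
Qed.

Lemma logder_mul f1 g1 f2 g2 :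
  logder f1 g1 -> logder f2 g2 ->
  logder (fps_mul f1 f2) (fun n => g1 n + g2 n).
Proof.
move=> [f10 g10 D1] [f20 g20 D2]; split.
- by rewrite /fps_mul big_ord1 f10 f20 mulr1.
- by rewrite g10 g20 addr0.
move=> n; pose N := n.+1; have ltnN : (n < N)%N by [].
pose p1 := trunc N f1; pose p2 := trunc N f2.
pose q1 := trunc N g1; pose q2 := trunc N g2.
have P12 : agree N (fps_mul f1 f2) (p1 * p2).
  by apply: agree_mul; exact: trunc_agree.
have Q12 : agree N (fun n => g1 n + g2 n) (q1 + q2).
  by move=> i lti; rewrite coefD !trunc_agree.
rewrite -(agree_mul Q12 P12) // -(agree_deriv P12) //.
rewrite derivM mulrDr mulrDl coefD [RHS]coefD; congr (_ + _).
  rewrite !mulrA; apply: (@agree_coef_mul N) => // j ltj.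
  rewrite (agree_deriv (trunc_agree (N := N) f1)) // D1.
  by rewrite -(agree_mul (trunc_agree (N := N) _) (trunc_agree (N := N) _)).
rewrite [p1 * p2^`()]mulrC [p1 * p2]mulrC !mulrA.
apply: (@agree_coef_mul N) => // j ltj.
rewrite (agree_deriv (trunc_agree (N := N) f2)) // D2.
by rewrite -(agree_mul (trunc_agree (N := N) _) (trunc_agree (N := N) _)).
Qed.

Lemma logder_prod (I : Type) (s : seq I) (P : pred I) (F G : I -> fps A) :
  (forall i, P i -> logder (F i) (G i)) ->
  logder (\big[@fps_mul A/fps_one A]_(i <- s | P i) F i)
         (fun n => \sum_(i <- s | P i) G i n).
Proof.
move=> FG; elim: s => [|i s [H0 H1 H2]].
  rewrite big_nil; case: logder_one => H0 H1 H2; split=> // [|n].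
    by rewrite big_nil.
  by rewrite H2 /fps_mul; apply: eq_bigr => k _; rewrite big_nil.
have [Pi|nPi] := boolP (P i); rewrite big_cons; last first.
  rewrite (negPf nPi); split=> // [|n]; first by rewrite big_cons (negPf nPi).
  by rewrite H2; apply: eq_bigr => k _; rewrite big_cons (negPf nPi).
rewrite Pi; have [K0 K1 K2] := logder_mul (FG i Pi) (And3 H0 H1 H2).
split=> // [|n]; first by rewrite big_cons Pi.
by rewrite K2; apply: eq_bigr => k _; rewrite big_cons Pi.
Qed.

(** The coefficient of u^n in u f' = g f gives n f_n from earlier coefficients,
and n is invertible in characteristic 0. *)
Lemma logder_inj f1 g1 f2 g2 n :
  logder f1 g1 -> logder f2 g2 ->
  (forall k, (k <= n)%N -> g1 k = g2 k) -> f1 n = f2 n.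
Proof.
move=> [f10 g10 D1] [f20 g20 D2].
elim/ltn_ind: n => -[|n] IHn eqg; first by rewrite f10 f20.
have: f1 n.+1 *+ n.+1 = f2 n.+1 *+ n.+1.
  rewrite D1 D2 /fps_mul big_ord_recl [RHS]big_ord_recl /= g10 g20 !mul0r.
  congr (_ + _).
  apply: eq_bigr => k _; have := ltn_ord k => ltk.
  rewrite eqg ?IHn //; rewrite /bump /=; try lia.
  by move=> j lej; apply: eqg; lia.
rewrite -!(scaler_nat (R := R)).
have neq0 : n.+1%:R != 0 :> R by rewrite pnatr_eq0.
by move/(congr1 (fun x => n.+1%:R^-1 *: x)); rewrite !scalerA mulVf // !scale1r.
Qed.

(** The derivative of the truncated exponential [e M.+1] is p' times [e M]; the
term that is lost has no influence below degree M, as u divides f. *)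
Lemma logder_exp f : f 0%N = 0 -> logder (fps_exp f) (fun n => f n *+ n).
Proof.
move=> f0; split=> [||n]; rewrite ?mulr0n //.
  by rewrite /fps_exp /fps_sum big_nil addr0.
pose N := n.+1; pose p := trunc N f.
pose e M : {poly A} := \sum_(k < M) ((k`!%:R : R)^-1)%:A *: p ^+ k.
have powE k i : (i < N)%N -> (p ^+ k)`_i = fps_pow f k i.
  by move=> ltiN; rewrite (agree_pow k (trunc_agree (N := N) f)).
have expE M i : (i <= M)%N -> (i <= n)%N -> fps_exp f i = (e M.+1)`_i.
  move=> leM lei.
  rewrite /fps_exp /fps_sum /e coef_sum.
  rewrite -(big_mkord xpredT (fun k => (((k`!%:R : R)^-1)%:A *: p ^+ k)`_i)).
  rewrite big_ltn // fact0 invr1 !scale1r expr0 coef1; congr (_ + _).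
  rewrite [RHS](@big_cat_nat _ _ _ i.+1) //=.
  rewrite [X in _ + X]big_nat_cond [X in _ + X]big1 ?addr0.
    by apply: eq_bigr => k _; rewrite coefZ powE // mulr_algl.
  move=> k /andP[/andP[ltk _] _].
  by rewrite coefZ powE ?fps_pow_lt ?mulr0.
rewrite (expE n) // -(@agree_deriv N (fun i => (e n.+1)`_i) (e n.+1)) //.
have -> : (e n.+1)^`() = p^`() * e n.
  rewrite /e raddf_sum big_ord_recl expr0 /= derivZ derivC scaler0 add0r.
  rewrite mulr_sumr; apply: eq_bigr => k _.
  rewrite derivZ deriv_exp /= -scalerAr -scaler_nat scalerA; congr (_ *: _).
  rewrite mulr_algl -[X in _ *: X](scaler_nat (R := R)) scalerA.
  congr (_%:A).
  rewrite factS natrM invfM -mulrA [X in _ * X = _]mulrC mulrA mulVf ?mul1r //.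
  by rewrite pnatr_eq0.
have [n0|n_gt0] := posnP n.
  by rewrite n0 coefXM /fps_mul big_ord1 mulr0n mul0r.
rewrite mulrA coefM; apply: eq_bigr => -[[|k] ltk] _ /=.
  by rewrite coefXM mulr0n !mul0r.
rewrite (agree_deriv (trunc_agree (N := N) f)) //.
by rewrite (expE n.-1) ?prednK //; move: ltk n_gt0; rewrite ltnS; lia.
Qed.

End LogarithmicDerivative.

(** * The factor of a single orbit *)

Lemma sum_multiples (V : nmodType) d q (F : nat -> V) : (0 < d)%N ->
  \sum_(k < (d * q).+1) (if (d %| k)%N then F (k %/ d)%N else 0) =
  \sum_(j < q.+1) F j.
Proof.
move=> d_gt0.
rewrite -(big_mkord xpredT (fun k => if (d %| k)%N then F (k %/ d)%N else 0)).
elim: q => [|q IHq]; first by rewrite muln0 big_nat1 big_ord1 dvdn0 div0n.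
rewrite (@big_cat_nat _ _ _ (d * q).+1) //= ?ltnS ?leq_mul2l ?leqnSn ?orbT //.
rewrite IHq [RHS]big_ord_recr; congr (_ + _).
rewrite big_nat_recr /=; last by rewrite ltn_mul2l d_gt0 ltnSn.
rewrite dvdn_mulr // mulKn // big_nat_cond big1 ?add0r // => k.
rewrite andbT => /andP[lbk ubk]; case: ifP => // /dvdnP[j kE].
by move: lbk ubk; rewrite kE ![(_ * d)%N]mulnC !ltn_mul2l d_gt0 /=; lia.
Qed.

Section LocalFactor.

Variables (R : numFieldType) (A : comAlgType R).
Implicit Types (f g : fps A) (y z : A).

Lemma logder_ext f f' g g' : f =1 f' -> g =1 g' -> logder f g -> logder f' g'.
Proof.
move=> ff gg [f0 g0 D]; split=> [||n]; rewrite -?ff -?gg ?D //.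
by apply: eq_bigr => k _; rewrite ff gg.
Qed.

(** The series f (u^d). *)
Definition dilate d f : fps A := fun n => if (d %| n)%N then f (n %/ d)%N else 0.

Lemma logder_dilate d f g : (0 < d)%N ->
  logder f g -> logder (dilate d f) (fun n => dilate d g n *+ d).
Proof.
move=> d_gt0 [f0 g0 D].
split; rewrite /dilate ?dvdn0 ?div0n ?f0 ?g0 ?mul0rn // => n.
have [/dvdnP[q ->]|ndvd] := boolP (d %| n)%N; last first.
  rewrite mul0rn /fps_mul big1 // => k _.
  have := ltn_ord k; rewrite ltnS => lek.
  case: ifP => dk; rewrite ?mul0rn ?mul0r //; case: ifP => dnk; rewrite ?mulr0 //.
  by rewrite -(subnK lek) dvdn_add in ndvd.
rewrite mulnK // mulrnA D [(q * d)%N]mulnC /fps_mul.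
rewrite -(sum_multiples q (fun j => g j * f (q - j)%N) d_gt0) -sumrMnl.
apply: eq_bigr => k _; case: ifP => [|_]; last by rewrite !mul0rn mul0r.
case/dvdnP=> j kE; have := ltn_ord k; rewrite kE mulnC ltnS leq_mul2l => lek.
by rewrite mulKn // -mulnBr dvdn_mulr // mulKn // mulrnAl.
Qed.

Lemma dilateE d f k : (0 < d)%N -> f 0%N = 0 ->
  dilate d f k = \sum_(1 <= r < k.+1) if (k == d * r)%N then f r else 0.
Proof.
move=> d_gt0 f0; rewrite /dilate; case: ifP => [/dvdnP[q ->]|ndvd].
  rewrite mulnK //; have [->|q_gt0] := posnP q.
    by rewrite f0 big1_seq // => r _; case: ifP => //; lia.
  rewrite (bigD1_seq q) ?iota_uniq //=.
    rewrite mulnC eqxx big1 ?addr0 // => r neqr.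
    by rewrite eqn_mul2l [q == r]eq_sym (negPf neqr) orbF ifF //; lia.
  by rewrite mem_index_iota q_gt0 ltnS leq_pmulr.
rewrite big1 // => r _; case: eqP => // kE.
by rewrite kE dvdn_mulr in ndvd.
Qed.

(** For a negative orbit this is (1 + y u) / (1 - z u^2), otherwise
1 / (1 - y u). *)
Definition orbit_factor (s : bool) y z : fps A :=
  fun k => if s then y ^+ odd k * z ^+ k./2 else y ^+ k.

(** From log (1 + y u) = - sum of (- y u)^r / r, and
- log (1 - z u^2) = sum of z^j u^(2 j) / j, which only has even powers of u. *)
Definition orbit_logder (s : bool) y z : fps A :=
  fun r => if r == 0%N then 0
           else if s then - (- y) ^+ r + (if odd r then 0 else z ^+ r./2 *+ 2)
           else y ^+ r.

Lemma logder_geometric y :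
  logder (fun n => y ^+ n) (fun n => if n == 0%N then 0 else y ^+ n).
Proof.
split=> // n; rewrite /fps_mul big_ord_recl mul0r add0r.
rewrite (eq_bigr (fun=> y ^+ n)) ?sumr_const ?card_ord // => k _.
by rewrite /= -exprD; have := ltn_ord k; rewrite /bump /= => ?; congr (_ ^+ _); lia.
Qed.

Lemma logder_binomial y :
  logder (fun n => if n == 0%N then 1 else if n == 1%N then y else 0)
         (fun n => if n == 0%N then 0 else - (- y) ^+ n).
Proof.
split=> // n; rewrite /fps_mul big_ord_recl mul0r add0r.
case: n => [|n]; first by rewrite big_ord0 mulr0n.
rewrite big_ord_recr /= /bump /= add1n subnn mulr1.
case: n => [|n]; first by rewrite big_ord0 add0r expr1 opprK.
rewrite big_ord_recr /= big1 => [|k _]; last first.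
  by have := ltn_ord k => ltk; do 2 (rewrite ifF; last by lia); rewrite mulr0.
rewrite ifF; last by lia.
rewrite ifT; last by lia.
by rewrite mul0rn add0r [in RHS]exprS; ring.
Qed.

Lemma logder_orbit s y z : logder (orbit_factor s y z) (orbit_logder s y z).
Proof.
case: s; last exact: logder_geometric.
have D2 := @logder_dilate 2 _ _ isT (logder_geometric z).
apply: logder_ext (logder_mul (logder_binomial y) D2) => n; last first.
  rewrite /orbit_logder /dilate dvdn2 divn2.
  case: n => [|n]; first by rewrite /= mul0rn addr0.
  by rewrite /= uphalf_half; case: (odd n); rewrite /= ?mul0rn.
rewrite /orbit_factor /dilate /fps_mul.
case: n => [|n]; first by rewrite big_ord1 /= !mul1r.
rewrite big_ord_recl big_ord_recl /= big1 => [|k _]; last by rewrite mul0r.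
rewrite addr0 mul1r subn1 /= !dvdn2 !divn2 /=.
have -> : uphalf n = if odd n then n./2.+1 else n./2 by rewrite uphalf_half; case: odd.
by case: (odd n); rewrite /= ?mulr0 ?mul1r ?addr0 ?add0r ?expr1.
Qed.

End LocalFactor.

(** * Moebius inversion *)

(** With [moebius_sqM], this is what makes the divisors cancel in pairs in
[sum_moebius]. *)
Lemma moebius_primeM l d : prime l -> (0 < d)%N -> ~~ (l %| d)%N ->
  moebius (l * d) = - moebius d.
Proof.
move=> pr_l d_gt0 ldvd; have l_gt0 := prime_gt0 pr_l.
have nl : l \notin primes d by rewrite mem_primes pr_l d_gt0.
have pE : perm_eq (primes (l * d)) (l :: primes d).
  apply: uniq_perm; rewrite /= ?nl ?primes_uniq // => x.
  by rewrite primesM // primes_prime // !inE.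
rewrite /moebius (perm_all _ pE) (perm_size pE) /= lognM // logn_prime // eqxx.
rewrite lognE pr_l d_gt0 (negPf ldvd) addn0 eqxx /= exprS mulN1r.
rewrite (@eq_in_all _ _ (fun l => logn l d == 1%N)); first by case: all; rewrite ?oppr0.
move=> x xd /=; rewrite lognM // logn_prime //.
by case: (x =P l) => // xl; rewrite -xl xd in nl.
Qed.

Lemma moebius_sqM l d : prime l -> (0 < d)%N -> (l ^ 2 %| d)%N -> moebius d = 0.
Proof.
move=> pr_l d_gt0; rewrite pfactor_dvdn // => lelog.
rewrite /moebius ifF //; apply/negbTE/allPn; exists l; last by lia.
by rewrite -logn_gt0; lia.
Qed.

(** For a prime l dividing n, only the divisors not divisible by the square of l
count, and they cancel in pairs d, l d with d prime to l. *)
Lemma sum_moebius n : (0 < n)%N ->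
  \sum_(d <- divisors n) moebius d = (n == 1%N)%:R.
Proof.
move=> n_gt0; have [->|n_neq1] := eqVneq; first by rewrite big_seq1.
have pr_l : prime (pdiv n) by rewrite pdiv_prime; lia.
move: (pdiv n) (pdiv_dvd n) pr_l => l dvd_ln pr_l.
have l_gt0 := prime_gt0 pr_l.
rewrite (bigID (fun d => l %| d)%N) /= -big_filter.
rewrite (bigID (fun d => l ^ 2 %| d)%N) /= big1_seq ?add0r; last first.
  move=> d /andP[l2d]; rewrite mem_filter -dvdn_divisors // => /andP[_ dn].
  by rewrite (moebius_sqM pr_l) // (dvdn_gt0 n_gt0).
rewrite -big_filter -[X in _ + X]big_filter.
set s := [seq d <- divisors n | ~~ (l %| d)%N].
rewrite (perm_big [seq (l * d)%N | d <- s]) /=; last first.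
  apply: uniq_perm.
  - by rewrite !filter_uniq // divisors_uniq.
  - rewrite map_inj_in_uniq ?filter_uniq ?divisors_uniq // => x y _ _ /eqP.
    by rewrite eqn_pmul2l // => /eqP.
  move=> d; rewrite !mem_filter -dvdn_divisors //.
  apply/idP/mapP => [/and3P[nl2 /dvdnP[e dE] dn]|[e]].
    exists e; last by rewrite mulnC.
    rewrite mem_filter -dvdn_divisors //; move: nl2 dn.
    rewrite dE [(e * l)%N]mulnC expnS expn1 dvdn_pmul2l // => -> /=.
    by apply: dvdn_trans; rewrite dvdn_mull.
  rewrite mem_filter -dvdn_divisors // => /andP[nle en] ->.
  rewrite expnS expn1 dvdn_pmul2l // nle dvdn_mulr //=.
  by rewrite Gauss_dvd ?dvd_ln // prime_coprime.
rewrite big_map -big_split big1_seq //= => d.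
rewrite mem_filter -dvdn_divisors // => /andP[nld dn].
by rewrite moebius_primeM ?addNr // (dvdn_gt0 n_gt0).
Qed.

(** Inversion in two variables: the substitution of (i / d, d r) for (i, r) keeps
the product i r and turns successive divisors into their product. *)
Lemma moebius_inversion (A : comNzRingType) (F D : nat -> nat -> A) N :
  (forall i r, (0 < i <= N)%N -> (0 < r)%N ->
     F i r = \sum_(d <- divisors i) D (i %/ d)%N (d * r)%N) ->
  forall i r, (0 < i <= N)%N -> (0 < r)%N ->
  D i r = \sum_(d <- divisors i) (moebius d)%:~R * F (i %/ d)%N (d * r)%N.
Proof.
move=> FE i r /andP[i_gt0 leiN] r_gt0.
transitivity (\sum_(g <- divisors i) D (i %/ g)%N (g * r)%N *
    (\sum_(d <- divisors g) moebius d)%:~R).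
  rewrite (bigD1_seq 1%N) ?divisors_uniq -?dvdn_divisors //= divn1 mul1n.
  rewrite big_seq1 mulr1 big_seq_cond big1 ?addr0 // => g.
  rewrite -dvdn_divisors // => /andP[/(dvdn_gt0 i_gt0) g_gt0 /negPf g1].
  by rewrite sum_moebius // g1 mulr0.
transitivity (\sum_(d <- divisors i) \sum_(e <- divisors (i %/ d))
    (moebius d)%:~R * D (i %/ d %/ e)%N (e * (d * r))%N); last first.
  rewrite big_seq [RHS]big_seq; apply: eq_bigr => d.
  rewrite -dvdn_divisors // => di; have d_gt0 := dvdn_gt0 i_gt0 di.
  have id_gt0 : (0 < i %/ d)%N by rewrite divn_gt0 // dvdn_leq.
  rewrite FE ?mulr_sumr ?muln_gt0 ?d_gt0 ?id_gt0 //=.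
  by rewrite (leq_trans (leq_div _ _)).
transitivity (\sum_(g <- divisors i) \sum_(d <- divisors i | (d %| g)%N)
    (moebius d)%:~R * D (i %/ g)%N (g * r)%N).
  rewrite big_seq [RHS]big_seq; apply: eq_bigr => g.
  rewrite -dvdn_divisors // => gi; have g_gt0 := dvdn_gt0 i_gt0 gi.
  rewrite raddf_sum mulr_sumr /=.
  rewrite -[RHS]big_filter (perm_big [seq d <- divisors i | (d %| g)%N]) /=.
    by apply: eq_bigr => d _; rewrite mulrC.
  apply: uniq_perm; rewrite ?filter_uniq ?divisors_uniq // => d.
  rewrite mem_filter -!dvdn_divisors //.
  by apply/idP/andP => [dg|[]//]; split=> //; exact: dvdn_trans gi.
rewrite (exchange_big_dep xpredT) //= big_seq [RHS]big_seq.
apply: eq_bigr => d; rewrite -dvdn_divisors // => di.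
have d_gt0 := dvdn_gt0 i_gt0 di.
have id_gt0 : (0 < i %/ d)%N by rewrite divn_gt0 // dvdn_leq.
rewrite -big_filter (perm_big [seq (d * e)%N | e <- divisors (i %/ d)]) /=.
  rewrite big_map; apply: eq_bigr => e _.
  by rewrite divnMA mulnA [(d * e)%N]mulnC.
apply: uniq_perm.
- by rewrite filter_uniq // divisors_uniq.
- rewrite map_inj_uniq ?divisors_uniq // => x y /eqP.
  by rewrite eqn_pmul2l // => /eqP.
move=> g; rewrite mem_filter -dvdn_divisors //.
apply/andP/mapP => [[/dvdnP[e ->] gi]|[e]].
  exists e; last by rewrite mulnC.
  by rewrite -dvdn_divisors // -(dvdn_pmul2l d_gt0) mulnC [(d * _)%N]mulnC divnK.
rewrite -dvdn_divisors // -(dvdn_pmul2l d_gt0) => h ->.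
by rewrite dvdn_mulr //; move: h; rewrite [(d * (i %/ _))%N]mulnC divnK.
Qed.

(** * Cyclic words *)

Section Orbits.

Variables (T : finType) (f : T -> T).
Hypothesis f_inj : injective f.

Lemma dvdn_order t i : (fingraph.order f t %| i)%N = (iter i f t == t).
Proof.
have iterM k : iter (k * fingraph.order f t) f t = t.
  by elim: k => // k IHk; rewrite mulSn iterD IHk iter_order.
rewrite {2}(divn_eq i (fingraph.order f t)) addnC iterD iterM.
have lt_mod : (i %% fingraph.order f t < fingraph.order f t)%N.
  by rewrite ltn_mod fingraph.order_gt0.
apply/eqP/eqP => [->//|it]; rewrite -(findex_iter lt_mod) it.
exact: findex0.
Qed.

Lemma order_image t : fingraph.order f (f t) = fingraph.order f t.
Proof.
apply/eqP; rewrite eqn_dvd !dvdn_order -iterSr iterS iter_order // eqxx andTb.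
by apply/eqP/f_inj; rewrite -iterS iterSr iter_order.
Qed.

Lemma order_iter t k : fingraph.order f (iter k f t) = fingraph.order f t.
Proof. by elim: k => //= k IHk; rewrite order_image. Qed.

Lemma big_orbits (V : Type) (idx : V) (op : Monoid.com_law idx) (F : T -> V) :
  \big[op/idx]_t F t =
  \big[op/idx]_(r | froots f r)
     \big[op/idx]_(h < fingraph.order f r) F (iter h f r).
Proof.
have symf := fconnect_sym f_inj.
rewrite (partition_big (froot f) (fun r => froots f r)) /=; last first.
  by move=> t _; exact: roots_root.
apply: eq_bigr => r /eqP rE.
rewrite (eq_bigl (fun t => t \in fingraph.orbit f r)); last first.
  by move=> t; rewrite -fconnect_orbit -{1}rE root_connect // symf.
rewrite -big_uniq ?orbit_uniq //= /fingraph.orbit.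
rewrite -[traject _ _ _](mkseq_nth r) size_traject /mkseq big_map.
rewrite -{1}[fingraph.order f r]subn0.
by rewrite big_mkord; apply: eq_bigr => h _; rewrite nth_traject.
Qed.

End Orbits.

Section CyclicWords.

Variables (T : finType) (P' : nat).
Local Notation P := P'.+1.

(** Periodic sequences of letters whose period divides [P].  Fixing a common
multiple [P] of all periods in use puts them in one finite type. *)
Definition cword := {ffun 'I_P -> T}.
Implicit Types t : cword.

Definition letter t (h : nat) : T := t (inZp h).

Definition shift t : cword := [ffun h : 'I_P => letter t h.+1].

Definition unshift t : cword := [ffun h : 'I_P => letter t (h + P')].

Lemma letter_modn t h : letter t (h %% P) = letter t h.
Proof. by congr (t _); apply: val_inj; rewrite /= modn_mod. Qed.

Lemma letter_ord t (h : 'I_P) : letter t h = t h.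
Proof. by rewrite /letter valZpK. Qed.

Lemma cwordP t t' :
  (forall h, (h < P)%N -> letter t h = letter t' h) -> t = t'.
Proof. by move=> tt; apply/ffunP => h; rewrite -!letter_ord tt. Qed.

Lemma letter_shift t h : letter (shift t) h = letter t h.+1.
Proof.
rewrite {1}/letter ffunE -[RHS]letter_modn -letter_modn /=.
by rewrite -addn1 modnDml addn1.
Qed.

Lemma letter_unshift t h : letter (unshift t) h = letter t (h + P').
Proof.
by rewrite {1}/letter ffunE -[RHS]letter_modn -letter_modn /= modnDml.
Qed.

Lemma letter_iter t k h : letter (iter k shift t) h = letter t (h + k).
Proof.
elim: k h => [|k IHk] h; first by rewrite addn0.
by rewrite iterS letter_shift IHk addSnnS.
Qed.

Lemma letter_addP t h : letter t (h + P) = letter t h.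
Proof. by rewrite -letter_modn modnDr letter_modn. Qed.

Lemma shiftK : cancel shift unshift.
Proof.
move=> t; apply: cwordP => h _.
by rewrite letter_unshift letter_shift -addnS letter_addP.
Qed.

Lemma unshiftK : cancel unshift shift.
Proof.
move=> t; apply: cwordP => h _.
by rewrite letter_shift letter_unshift addSnnS letter_addP.
Qed.

Definition shift_inj : injective shift := can_inj shiftK.

Definition period t := fingraph.order shift t.

Lemma period_gt0 t : (0 < period t)%N.
Proof. exact: fingraph.order_gt0. Qed.

Lemma period_dvdP t i : reflect (iter i shift t = t) (period t %| i)%N.
Proof. by rewrite /period (dvdn_order shift_inj); exact: eqP. Qed.

Lemma period_shift t : period (shift t) = period t.
Proof. exact: order_image shift_inj t. Qed.

Lemma letter_addM t h k : letter t (h + k * period t) = letter t h.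
Proof.
by rewrite -letter_iter (_ : iter _ _ _ = t) //; apply/period_dvdP/dvdn_mull.
Qed.

Lemma big_period_shift (V : Type) (idx : V) (op : Monoid.com_law idx)
    (G : T -> V) t :
  \big[op/idx]_(h < period t) G (letter (shift t) h) =
  \big[op/idx]_(h < period t) G (letter t h).
Proof.
have := letter_addM t 0 1.
case: (period t) (period_gt0 t) => // d _; rewrite add0n mul1n => per.
rewrite big_ord_recr big_ord_recl Monoid.mulmC letter_shift per.
by congr (op _ _); apply: eq_bigr => h _; rewrite letter_shift.
Qed.

Section PeriodProduct.

Variables (V : comNzRingType) (G : T -> V).

Definition period_prod t := \prod_(h < period t) G (letter t h).

Lemma period_prod_shift t : period_prod (shift t) = period_prod t.
Proof. by rewrite /period_prod period_shift big_period_shift. Qed.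

Lemma period_prod_exp t k :
  \prod_(h < k * period t) G (letter t h) = period_prod t ^+ k.
Proof.
elim: k => [|k IHk]; first by rewrite mul0n big_ord0 expr0.
rewrite mulSn addnC big_split_ord /= IHk exprSr; congr (_ * _).
by apply: eq_bigr => h _; rewrite addnC letter_addM.
Qed.

(** A sequence whose period divides i repeats its first i letters, and these are
arbitrary since i divides [P]. *)
Lemma sum_period_dvdn i : (0 < i)%N -> (i %| P)%N ->
  \sum_(t : cword | (period t %| i)%N) period_prod t ^+ (i %/ period t) =
  (\sum_a G a) ^+ i.
Proof.
case: i => // i _ iP; rewrite -[i.+1 in RHS]card_ord -prodr_const.
rewrite bigA_distr_bigA /=.
(* Repetition of a block of i letters, and its inverse. *)
pose u (g : {ffun 'I_i.+1 -> T}) : cword := [ffun h : 'I_P => g (inZp h)].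
pose v t : {ffun 'I_i.+1 -> T} := [ffun h : 'I_i.+1 => letter t h].
have letter_u g h : letter (u g) h = g (inZp h).
  by rewrite /letter ffunE; congr (g _); apply: val_inj; rewrite /= modn_dvdm.
have uK : cancel u v.
  by move=> g; apply/ffunP => h; rewrite ffunE letter_u valZpK.
rewrite (reindex_onto u v) /=; last first.
  move=> t pi; apply: cwordP => h _; rewrite letter_u ffunE /=.
  rewrite [in RHS](divn_eq h i.+1) addnC.
  by case/dvdnP: pi => k ->; rewrite mulnA letter_addM.
have uper g : (period (u g) %| i.+1)%N.
  apply/period_dvdP/cwordP => h _; rewrite letter_iter !letter_u.
  by congr (g _); apply: val_inj; rewrite /= modnDr.
apply: eq_big => [g|g _]; first by rewrite uper uK eqxx.
rewrite -period_prod_exp divnK //; apply: eq_bigr => h _.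
by rewrite letter_u valZpK.
Qed.

End PeriodProduct.

Section PrimitiveSums.

Variables (R : comNzRingType) (neg : T -> bool) (a : T -> R).

(** Whether the product of the signs of the letters over one period is -1. *)
Definition negative t := odd (\sum_(h < period t) neg (letter t h)).

Lemma period_prod_sign t :
  period_prod (fun x => (-1) ^+ neg x) t = (-1) ^+ negative t :> R.
Proof. by rewrite /negative signr_odd /period_prod -expr_sum. Qed.

(** The coefficient of x_i^r u^(i r) in the logarithmic derivative of the product
over the orbits.  An orbit of size i contributes i times the r-th power of its
weight, with sign (-1)^(r+1) if it is negative, and so each of its i elements
contributes once.  A negative orbit of size i / 2 contributes through the factor
1 / (1 - c^2 x_i u^i), that is i times the r-th power of c^2, so each of its
elements contributes twice. *)
Definition orbit_power_sum i r : R :=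
  \sum_(t : cword | period t == i) (-1) ^+ (negative t * r.+1) * period_prod a t ^+ r
  + \sum_(t : cword | negative t && (2 * period t == i)%N)
       period_prod a t ^+ (2 * r) *+ 2.

(** Each sequence t whose period divides i, with i = D (period t), appears once on
the left, and on the right in the first sum for d = D and, if negative, in the
second sum for 2 d = D.  The signs on both sides agree unless t is negative and D
even; then the first sum has the wrong sign, and the second one, with its
factor 2, makes up for it. *)
Lemma power_sum_orbits i r : (0 < i)%N -> (i %| P)%N -> (0 < r)%N ->
  (\sum_x (-1) ^+ (neg x * r.+1) * a x ^+ r) ^+ i =
  \sum_(d <- divisors i) orbit_power_sum (i %/ d)%N (d * r)%N.
Proof.
move=> i_gt0 iP r_gt0; rewrite -sum_period_dvdn // /orbit_power_sum.
under [RHS]eq_bigr do rewrite ![\sum_(t : cword | _) _]big_mkcond -big_split /=.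
rewrite exchange_big /= big_mkcond; apply: eq_bigr => t _.
have p_gt0 := period_gt0 t.
have period_prodE : period_prod (fun x => (-1) ^+ (neg x * r.+1) * a x ^+ r) t =
    (-1) ^+ (negative t * r.+1) * period_prod a t ^+ r.
  rewrite exprM -period_prod_sign /period_prod big_split /= -!prodrXl; congr (_ * _).
  by apply: eq_bigr => h _; rewrite exprM.
case: ifPn => [/dvdnP[D iE]|ndvd]; last first.
  rewrite big_seq big1 // => d; rewrite -dvdn_divisors // => di.
  rewrite !ifF ?addr0 //; apply: contraNF ndvd.
    by move/andP=> [_ /eqP h]; rewrite -(divnK di) -h mulnAC dvdn_mull.
  by move/eqP=> ->; rewrite -{2}(divnK di) dvdn_mulr.
have D_gt0 : (0 < D)%N by move: i_gt0; rewrite iE; case: D {iE}.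
have eqdiv d : (d %| i)%N -> (period t == i %/ d)%N = (d == D).
  move=> di; rewrite eqn_div ?(dvdn_gt0 i_gt0) // iE mulnC.
  by rewrite eqn_pmul2r.
have eqdiv2 d : (d %| i)%N -> (2 * period t == i %/ d)%N = (2 * d == D)%N.
  move=> di; rewrite eqn_div ?(dvdn_gt0 i_gt0) // iE.
  by rewrite mulnAC eqn_pmul2r.
rewrite {}period_prodE iE mulnK // -iE.
rewrite big_split /= (bigD1_seq D) ?divisors_uniq -?dvdn_divisors //=; last first.
  by rewrite iE dvdn_mulr.
rewrite eqdiv ?eqxx; last by rewrite iE dvdn_mulr.
rewrite big_seq_cond big1 ?addr0; last first.
  move=> d /andP[]; rewrite -dvdn_divisors // => di /negPf dD.
  by rewrite eqdiv // dD.
case: (boolP (negative t)) => neg_t; last first.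
  rewrite big1 ?addr0; last by [].
  by rewrite !mul0n !expr0 !mul1r -exprM mulnC.
rewrite !mul1n exprMn -!exprM [(r.+1 * D)%N]mulnC [(r * D)%N]mulnC /=.
have [/dvdnP[E DE]|nD] := boolP (2 %| D)%N; last first.
  rewrite big_seq big1 ?addr0.
    rewrite -(signr_odd _ (D * r.+1)) -(signr_odd _ (D * r).+1).
    by move: nD; rewrite dvdn2 negbK /= !oddM /= => ->.
  move=> d; rewrite -dvdn_divisors // => di; rewrite eqdiv2 // ifF //.
  by apply: contraNF nD => /eqP <-; rewrite dvdn_mulr.
rewrite (bigD1_seq E) ?divisors_uniq -?dvdn_divisors //=; last first.
  by rewrite iE DE -mulnA dvdn_mulr.
rewrite eqdiv2; last by rewrite iE DE -mulnA dvdn_mulr.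
rewrite DE [(2 * E)%N]mulnC eqxx big_seq_cond big1 ?addr0; last first.
  move=> d /andP[]; rewrite -dvdn_divisors // => di /negPf dE.
  by rewrite eqdiv2 // DE [(E * 2)%N]mulnC eqn_pmul2l // dE.
rewrite mulnA [(2 * E)%N]mulnC.
rewrite -(signr_odd _ (E * 2 * r.+1)) -(signr_odd _ (E * 2 * r).+1).
rewrite /= !oddM /= andbF expr0 expr1 mul1r mulN1r.
by rewrite mulr2n addrA addNr add0r.
Qed.

End PrimitiveSums.

End CyclicWords.

(** * The bijection between words and invariant multisets of cyclic words *)

Section SignedOrder.

Variables (T : finType) (rank : T -> nat) (neg : T -> bool).
Hypothesis rank_inj : injective rank.

(** [b] records whether an odd number of negative letters has been read. *)
Fixpoint flip_lex (b : bool) (u v : seq T) : bool :=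
  if (u, v) is (x :: u', y :: v') then
    (if b then rank y < rank x else rank x < rank y)%N ||
    (x == y) && flip_lex (b (+) neg x) u' v'
  else true.

Definition slex := flip_lex false.

Lemma flip_lexN b u v : flip_lex (~~ b) u v = flip_lex b v u.
Proof.
elim: u v b => [|x u IHu] [|y v] b //=.
rewrite if_neg addNb IHu [y == x]eq_sym.
by case: (x =P y) => [->|]; rewrite ?andbF.
Qed.

Lemma slex_cons x u y v :
  slex (x :: u) (y :: v) =
  (rank x < rank y)%N || (x == y) && (if neg x then slex v u else slex u v).
Proof. by rewrite /slex /=; case: (neg x); rewrite //= (flip_lexN false). Qed.

Lemma slex_refl u : slex u u.
Proof. by elim: u => // x u IHu; rewrite slex_cons IHu eqxx if_same orbT. Qed.

Lemma slex_total u v : size u = size v -> slex u v || slex v u.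
Proof.
elim: u v => [|x u IHu] [|y v] // [/IHu]; rewrite !slex_cons [y == x]eq_sym.
have [->|/eqP neq] := eqVneq x y; first by rewrite ltnn; case: neg => //=; rewrite orbC.
have /eqP : rank x <> rank y by move/rank_inj.
by rewrite neq_ltn => /orP[] -> //; rewrite orbT.
Qed.

Lemma slex_anti u v : size u = size v -> slex u v -> slex v u -> u = v.
Proof.
elim: u v => [|x u IHu] [|y v] // [/IHu {}IHu]; rewrite !slex_cons [y == x]eq_sym.
have [->|_] := eqVneq x y; last by rewrite !orbF => /ltnW; rewrite leqNgt => /negPf->.
by rewrite ltnn /=; case: neg => h1 h2; congr (_ :: _); apply: IHu.
Qed.

Lemma slex_trans v u w :
  size u = size v -> size v = size w -> slex u v -> slex v w -> slex u w.
Proof.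
elim: v u w => [|y v IHv] [|x u] [|z w] // [uv] [vw]; rewrite !slex_cons.
have [->|_] := eqVneq x y.
  rewrite ltnn /=; have [->|_ _] := eqVneq y z; last by rewrite !orbF.
  by rewrite ltnn /=; case: neg => h1 h2; apply: IHv.
rewrite orbF => lt_xy; have [<-|_] := eqVneq y z; first by rewrite lt_xy.
by rewrite orbF => /(ltn_trans lt_xy) ->.
Qed.

Lemma slex_rcons u v x :
  size u = size v -> slex (rcons u x) (rcons v x) = slex u v.
Proof.
rewrite /slex; elim: u v false => [|y u IHu] [|z v] b //= => [_|[uv]].
  by rewrite eqxx orbT.
by rewrite IHu.
Qed.

Section CyclicOrder.

Variable P' : nat.
Implicit Types t : cword T P'.

Definition spell t := mkseq (letter t) P'.+1.

(** Comparing one block of letters suffices, as it determines the sequence. *)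
Definition sle t t' := slex (spell t) (spell t').

Lemma size_spell t t' : size (spell t) = size (spell t').
Proof. by rewrite !size_mkseq. Qed.

Lemma sle_refl : reflexive sle.
Proof. by move=> t; exact: slex_refl. Qed.

Lemma sle_total : total sle.
Proof. by move=> t t'; apply: slex_total; exact: size_spell. Qed.

Lemma sle_trans : transitive sle.
Proof. by move=> t' t t''; apply: slex_trans; exact: size_spell. Qed.

Lemma sle_anti : antisymmetric sle.
Proof.
move=> t t' /andP[le_tt' le_t't].
have /(congr1 (fun u => nth (t 0) u)) eq_nth : spell t = spell t'.
  by apply: slex_anti => //; exact: size_spell.
by apply: cwordP => h lth; move: (congr1 (@^~ h) eq_nth); rewrite !nth_mkseq.
Qed.

(** Moving the last letter of a block to its front leaves the first P' letters to
be compared; when the last letters agree, this is the comparison of the full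
blocks. *)
Lemma sle_unshift t t' :
  sle (unshift t) (unshift t') =
  (rank (letter t P') < rank (letter t' P'))%N ||
  (letter t P' == letter t' P') &&
  (if neg (letter t P') then sle t' t else sle t t').
Proof.
have spell_unshift x : spell (unshift x) = letter x P' :: mkseq (letter x) P'.
  rewrite /spell /mkseq /= letter_unshift add0n (iotaDl 1 0) -map_comp.
  congr (_ :: _); apply: eq_map => h /=.
  by rewrite letter_unshift add1n addSnnS letter_addP.
rewrite {1}/sle !spell_unshift slex_cons /sle /spell !mkseqS.
by case: eqP => // ->; rewrite !slex_rcons ?size_mkseq.
Qed.

End CyclicOrder.

Section Words.

Variable n : nat.
Local Notation P' := (n`!.-1).
Local Notation word := {ffun 'I_n -> T}.

(** The letters w (s 0), w (s 1), ... increase, and the positions of a given letter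
appear in increasing order if it is positive and in decreasing order if it is
negative. *)
Definition sorts (w : word) (s : 'S_n) := forall i j : 'I_n, (i < j)%N ->
  (rank (w (s i)) < rank (w (s j)))%N ||
  (w (s i) == w (s j)) && (neg (w (s i)) (+) (s i < s j)%N).

(** The block length n! is a multiple of the order of [s].  Starting from s c rather
than c makes the order of the itineraries that of the cards, and makes w c the
last letter of the block. *)
Definition itinerary (w : word) (s : 'S_n) (c : 'I_n) : cword T P' :=
  [ffun h : 'I_(P'.+1) => w ((s ^+ h.+1)%g c)].

Lemma perm_expg_fact (s : 'S_n) : (s ^+ n`! = 1)%g.
Proof.
have /dvdnP[k ->] : (#[s]%g %| n`!)%N by rewrite -(card_Sn n) -cardsT cardSg ?subsetT.
by rewrite mulnC expgM expg_order expg1n.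
Qed.

Lemma letter_itinerary w s c h :
  letter (itinerary w s c) h = w ((s ^+ h.+1)%g c).
Proof.
rewrite /letter ffunE /=; congr (w _).
by rewrite !expgSr expg_mod // prednK ?fact_gt0 // perm_expg_fact.
Qed.

Lemma itinerary_perm w s c : itinerary w s (s c) = shift (itinerary w s c).
Proof.
apply: cwordP => h _; rewrite letter_shift !letter_itinerary.
by rewrite [in RHS]expgS permM.
Qed.

Lemma itinerary_iter w s c k :
  itinerary w s ((s ^+ k)%g c) = iter k (@shift _ _) (itinerary w s c).
Proof.
elim: k => [|k IHk]; first by rewrite expg0 perm1.
by rewrite expgSr permM itinerary_perm IHk.
Qed.

Lemma letter_itinerary_last w s c : letter (itinerary w s c) P' = w c.
Proof.
by rewrite letter_itinerary prednK ?fact_gt0 // perm_expg_fact perm1.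
Qed.

(** If c < c' then w (s c) <= w (s c') because [s] sorts [w]; in case of equality
s c and s c' are in the same or in the opposite order according to the sign of
that letter, as required for the comparison of the remaining letters. *)
Lemma sle_itinerary w s (c c' : 'I_n) : sorts w s -> (c <= c')%N ->
  sle (itinerary w s c) (itinerary w s c').
Proof.
move=> ws; rewrite /sle /spell.
rewrite (eq_mkseq (letter_itinerary w s c)) (eq_mkseq (letter_itinerary w s c')).
elim: (P'.+1) c c' => // k IHk c c'.
rewrite leq_eqVlt => /predU1P[/val_inj->|lt_cc']; first exact: slex_refl.
have mkS x : mkseq (fun h => w ((s ^+ h.+1)%g x)) k.+1 =
    w (s x) :: mkseq (fun h => w ((s ^+ h.+1)%g (s x))) k.
  rewrite /mkseq /= expg1 (iotaDl 1 0) -map_comp; congr (_ :: _).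
  by apply: eq_map => h /=; rewrite add1n expgS permM.
rewrite !mkS slex_cons; have := ws _ _ lt_cc'.
case: (_ < _)%N => //=; case: (_ == _) => //=.
by case: neg => /= [|/ltnW] le_s; apply: IHk; rewrite // leqNgt.
Qed.

Definition mult (w : word) (s : 'S_n) (t : cword T P') : nat :=
  \sum_c (itinerary w s c == t).

Lemma mult_shift w s t : mult w s (shift t) = mult w s t.
Proof.
rewrite /mult (reindex_inj (@perm_inj _ s)); apply: eq_bigr => c _.
by rewrite itinerary_perm (inj_eq (@shift_inj _ _)).
Qed.

Lemma count_itinerary w s t :
  count_mem t [seq itinerary w s c | c <- enum 'I_n] = mult w s t.
Proof. by rewrite count_map -sum1_count big_mkcond big_enum. Qed.

Lemma sum_mult w s : \sum_t mult w s t = n.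
Proof.
rewrite exchange_big /= (eq_bigr (fun=> 1%N)) ?sum1_card ?card_ord // => c _.
rewrite (bigD1 (itinerary w s c)) //= eqxx big1 ?addn0 // => t.
by rewrite eq_sym => /negPf->.
Qed.

(** The multiplicities determine the list of the itineraries by card, which is
sorted, and the last letter of an itinerary is the letter of the card. *)
Lemma mult_inj w s w' s' : sorts w s -> sorts w' s' ->
  (forall t, mult w s t = mult w' s' t) -> w = w'.
Proof.
move=> ws ws' eq_mult.
have srt u v : sorts u v -> sorted (@sle P') [seq itinerary u v c | c <- enum 'I_n].
  move=> uv; rewrite sorted_map.
  apply: (@sub_sorted _ (relpre val leq)) => [c c'|]; first exact: sle_itinerary.
  by rewrite -sorted_map val_enum_ord iota_sorted.
have eq_its : [seq itinerary w s c | c <- enum 'I_n] =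
                    [seq itinerary w' s' c | c <- enum 'I_n].
  apply: (sorted_eq (@sle_trans _) (@sle_anti _)); try exact: srt.
  by apply/allP => t _ /=; rewrite !count_itinerary eq_mult.
apply/ffunP => c; have /(_ c) eq_it : itinerary w s =1 itinerary w' s'.
  by move=> x; have /eq_in_map := eq_its; apply; rewrite mem_enum.
by rewrite -(letter_itinerary_last w s) eq_it letter_itinerary_last.
Qed.

(** Sort the sequences of the multiset into a list [L] and give card c the last
letter of L_c.  By invariance the sequences L_c preceded by their last letters
form the same multiset.  Listed along the sorting permutation of the word they
are again sorted, so that this list is [L]; hence L_(s c) is the shift of L_c,
and L_c is the itinerary of c. *)
Lemma mult_surj (st : word -> 'S_n) (M : cword T P' -> nat) :
  (forall w, sorts w (st w)) -> (forall t, M (shift t) = M t) ->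
  \sum_t M t = n -> exists w, forall t, mult w (st w) t = M t.
Proof.
move=> stP M_shift sumM.
(* The sequences with their multiplicities, not yet sorted. *)
pose L0 := flatten [seq nseq (M t) t | t <- enum {: cword T P'}].
have count_L0 t : count_mem t L0 = M t.
  rewrite /L0 count_flatten -map_comp sumnE big_map big_enum (bigD1 t) //=.
  rewrite count_nseq /= eqxx mul1n big1 ?addn0 // => t' /negPf nt.
  by rewrite count_nseq /= nt.
have size_L : size (sort (@sle P') L0) == n.
  rewrite size_sort size_flatten /shape -map_comp sumnE big_map big_enum /=.
  by under eq_bigr do rewrite size_nseq; rewrite sumM.
pose L := Tuple size_L.
have count_tuple (X : n.-tuple (cword T P')) t :
    count_mem t X = (\sum_c (tnth X c == t))%N.
  by rewrite -sum1_count big_tuple [LHS]big_mkcond.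
have count_L t : (\sum_c (tnth L c == t))%N = M t.
  by rewrite -count_tuple -count_L0; apply/seq.permP; rewrite /= perm_sort.
have sorted_L (c c' : 'I_n) : (c <= c')%N -> sle (tnth L c) (tnth L c').
  have [t0 _] : exists t0, t0 = tnth L c by exists (tnth L c).
  move=> lecc'; rewrite !(tnth_nth t0).
  apply: (sorted_leq_nth (@sle_trans _) (@sle_refl _)); rewrite ?inE ?size_tuple //.
  exact: sort_sorted (@sle_total _) _.
pose w : word := [ffun c => letter (tnth L c) P'].
exists w; set s := st w; pose L' := [tuple unshift (tnth L (s i)) | i < n].
have eqL : L' = L.
  apply: val_inj; apply: (sorted_eq (@sle_trans _) (@sle_anti _)).
  - rewrite /= -[tval (ord_tuple n)]/(val (ord_tuple n)) val_ord_tuple sorted_map.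
    apply: (@sub_sorted _ (relpre val ltn)) => [i j|]; last first.
      by rewrite -sorted_map val_enum_ord iota_ltn_sorted.
    move=> /(stP w) /=; rewrite sle_unshift !ffunE.
    case: (_ < _)%N => //=; case: (_ == _) => //=.
    by case: neg => /= [|/ltnW] le_s; apply: sorted_L; rewrite // leqNgt.
  - exact: sort_sorted (@sle_total _) _.
  apply/allP => t _; apply/eqP.
  rewrite (count_tuple L') (count_tuple L) (count_L t) -M_shift -count_L.
  rewrite [RHS](reindex_inj (@perm_inj _ s)).
  apply: eq_bigr => c _; rewrite tnth_mktuple /=.
  by rewrite -(can2_eq (@unshiftK _ _) (@shiftK _ _)).
have tnthL c : tnth L (s c) = shift (tnth L c).
  by rewrite -[in RHS]eqL tnth_mktuple unshiftK.
have itL c : itinerary w s c = tnth L c.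
  apply: cwordP => h _; rewrite letter_itinerary ffunE.
  have -> : tnth L ((s ^+ h.+1)%g c) = iter h.+1 (@shift _ _) (tnth L c).
    elim: h.+1 => [|k IHk]; first by rewrite expg0 perm1.
    by rewrite expgSr permM tnthL IHk.
  by rewrite letter_iter addnS addnC -addnS letter_addP.
by move=> t; rewrite -count_L /mult; apply: eq_bigr => c _; rewrite itL.
Qed.

End Words.

End SignedOrder.

(** * Cycles of the sorting permutation *)

Lemma card_porbit (T : finType) (s : {perm T}) c :
  #|porbit s c| = fingraph.order s c.
Proof.
apply: eq_card => x; rewrite inE; apply/porbitP/idP => [[k ->]|].
  by rewrite permX fconnect_iter.
by move=> cx; exists (findex s c x); rewrite permX iter_findex.
Qed.

Lemma ncycles_order n i (s : 'S_n) :
  (i * ncycles i s = \sum_c (fingraph.order s c == i))%N.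
Proof.
rewrite (partition_big (porbit s) (mem (porbits s))) => [|c _]; last exact: imset_f.
rewrite /ncycles -sum1_card big_distrr /=.
rewrite (eq_bigl (fun C => (C \in porbits s) && (#|C| == i))) => [|C];
  last by rewrite inE.
rewrite big_mkcondr; apply: eq_bigr => _ /imsetP[c _ ->].
rewrite (eq_bigl (mem (porbit s c))) => [|x]; last by rewrite /= eq_porbit_mem.
have eq_ord x : x \in porbit s c -> fingraph.order s x = #|porbit s c|.
  by rewrite -eq_porbit_mem => /eqP; rewrite -card_porbit => ->.
rewrite (eq_bigr (fun=> nat_of_bool (#|porbit s c| == i))) => [|x /eq_ord->//].
by rewrite sum_nat_const; case: eqP => [->|]; rewrite ?muln1 ?muln0.
Qed.

Section CycleType.

Variables (T : finType) (rank : T -> nat) (neg : T -> bool).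
Variables (n : nat) (w : {ffun 'I_n -> T}) (s : 'S_n).
Hypothesis ws : sorts rank neg w s.
Local Notation P' := (n`!.-1).
Local Notation itin := (itinerary w s).
Local Notation order := (fingraph.order s).
Local Notation mult := (mult w s).
Implicit Types t : cword T P'.

(** Every negative letter read reverses the order of the two cards. *)
Lemma ltn_expg k c c' : itin c = itin c' -> (c < c')%N ->
  ((s ^+ k)%g c < (s ^+ k)%g c')%N =
  ~~ odd (\sum_(h < k) neg (letter (itin c) h)).
Proof.
move=> eq_it lt_cc'; elim: k => [|k IHk].
  by rewrite big_ord0 expg0 !perm1 lt_cc'.
rewrite big_ord_recr oddD /= !expgSr !permM.
set x := (s ^+ k)%g c in IHk *; set y := (s ^+ k)%g c' in IHk *.
have wsx : w (s x) = letter (itin c) k by rewrite letter_itinerary expgSr permM.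
have wsy : w (s y) = letter (itin c) k by rewrite eq_it letter_itinerary expgSr permM.
have neq_xy : x != y by rewrite (inj_eq (@perm_inj _ _)) neq_ltn lt_cc'.
move: IHk; case: ltngtP => [lt_xy|lt_yx|/val_inj/eqP]; last by rewrite (negPf neq_xy).
  have := ws lt_xy; rewrite wsx wsy ltnn eqxx /=.
  by case: (odd _) => //=; case: (_ < _)%N; case: neg.
have := ws lt_yx; rewrite wsx wsy ltnn eqxx /=.
have /eqP : val (s x) <> val (s y).
  by move/val_inj/perm_inj/eqP; rewrite (negPf neq_xy).
by case: (odd _) => //=; case: ltngtP => //=; case: neg.
Qed.

Lemma period_dvdn_order c : (period (itin c) %| order c)%N.
Proof.
by apply/period_dvdP; rewrite -itinerary_iter permX (iter_order (@perm_inj _ s)).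
Qed.

(** The power k of [s] maps the set of cards with the itinerary of c to itself and
is increasing there; an increasing permutation of a finite chain is the
identity. *)
Lemma expg_id k c : (period (itin c) %| k)%N ->
  ~~ odd (\sum_(h < k) neg (letter (itin c) h)) -> (s ^+ k)%g c = c.
Proof.
move=> dvd_k even_k; pose f : 'S_n := (s ^+ k)%g.
have it_f x : itin x = itin c -> itin (f x) = itin c.
  by move=> xc; rewrite itinerary_iter xc; apply/period_dvdP.
have it_fX j : itin ((f ^+ j)%g c) = itin c.
  by elim: j => [|j IHj]; rewrite ?perm1 // expgSr permM it_f.
have mono x y : itin x = itin c -> itin y = itin c -> (x < y)%N -> (f x < f y)%N.
  by move=> xc yc lt_xy; rewrite ltn_expg ?xc ?yc.
have ford : (f ^+ (fingraph.order f c).-1.+1)%g c = c.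
  by rewrite prednK ?fingraph.order_gt0 // permX iter_order //; exact: perm_inj.
apply/eqP/contraT; rewrite -/f neq_ltn => /orP[lt_fc|lt_cf].
  (* The iterates of c would decrease forever, but they return to c. *)
  have lt_fX j : ((f ^+ j.+1)%g c < c)%N.
    elim: j => [|j IHj]; first by rewrite expg1.
    by rewrite expgSr permM (ltn_trans _ lt_fc) // mono.
  by have := lt_fX (fingraph.order f c).-1; rewrite ford ltnn.
have lt_fX j : (c < (f ^+ j.+1)%g c)%N.
  elim: j => [|j IHj]; first by rewrite expg1.
  by rewrite [(f ^+ j.+2)%g]expgSr permM (ltn_trans lt_cf) // mono.
by have := lt_fX (fingraph.order f c).-1; rewrite ford ltnn.
Qed.

(** After one period, or after two if the orbit is negative, an even number of
negative letters has been read. *)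
Lemma order_itinerary c : order c = period (itin c) \/
  negative neg (itin c) /\ order c = (2 * period (itin c))%N.
Proof.
have ordE k : (s ^+ k)%g c = c -> (order c %| k)%N.
  by rewrite permX => ?; rewrite dvdn_order //; [apply/eqP|exact: perm_inj].
have dvd_ord := period_dvdn_order c.
have [neg_t|pos_t] := boolP (negative neg (itin c)); last first.
  left; apply/eqP; rewrite eqn_dvd dvd_ord andbT.
  by apply/ordE/expg_id => //; exact: pos_t.
have : (order c %| 2 * period (itin c))%N.
  apply/ordE/expg_id; first exact: dvdn_mull.
  rewrite mul2n -addnn big_split_ord /= oddD.
  rewrite [X in _ (+) odd X](eq_bigr
    (fun h : 'I__ => nat_of_bool (neg (letter (itin c) h)))).
    by rewrite addbb.
  by move=> h _; rewrite addnC -[X in (_ + X)%N]mul1n letter_addM.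
case/dvdnP: dvd_ord => q ->; rewrite dvdn_pmul2r ?period_gt0 // => q2.
have : (q <= 2)%N by apply: dvdn_leq.
case: q q2 => [|[|[|]]] // _ _; first by left; rewrite mul1n.
by right.
Qed.

(** The number of cards of itinerary [t] on cycles of length [period t]. *)
Definition fixed_mult t := if negative neg t then odd (mult t) : nat else mult t.

(** If [t] is negative, the power [period t] of [s] is a decreasing involution of the
cards with itinerary [t].  It has as many cards going down as going up, and at
most one fixed card. *)
Lemma count_order t i : (\sum_c ((itin c == t) && (order c == i)))%N =
  ((period t == i) * fixed_mult t +
   (2 * period t == i) * (negative neg t * (mult t)./2 * 2))%N.
Proof.
have p_gt0 := period_gt0 t.
have ordP c : itin c = t -> order c = period t \/
   negative neg t /\ order c = (2 * period t)%N.
  by move=> <-; exact: order_itinerary.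
pose F := (\sum_c ((itin c == t) && (order c == period t)))%N.
pose F2 := (\sum_c ((itin c == t) && (order c == 2 * period t)))%N.
have multE : mult t = (F + F2)%N.
  rewrite /F /F2 -big_split; apply: eq_bigr => c _ /=.
  by case: eqP => // /ordP[->|[_ ->]]; rewrite ?eqxx /=; [case: eqP|case: eqP]; lia.
suff [FE F2E] : F = fixed_mult t /\ F2 = (negative neg t * (mult t)./2 * 2)%N.
  have [<-|ne1] := eqVneq (period t) i.
    have -> : (2 * period t == period t)%N = false by lia.
    by rewrite mul0n addn0 mul1n.
  have [<-|ne2] := eqVneq (2 * period t)%N i; first by rewrite -F2E mul0n mul1n.
  rewrite !mul0n big1 // => c _; case: eqP => // /ordP[->|[_ ->]].
    by rewrite (negPf ne1).
  by rewrite (negPf ne2).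
rewrite /fixed_mult; case: (boolP (negative neg t)) => neg_t; last first.
  have F20 : F2 = 0%N.
    rewrite /F2 big1 // => c _; case: eqP => // /ordP[->|[]].
      by case: eqP => //; lia.
    by rewrite (negPf neg_t).
  by rewrite multE F20 addn0 !mul0n.
pose f : 'S_n := (s ^+ period t)%g.
have itf c : (itin (f c) == t) = (itin c == t).
  rewrite itinerary_iter; apply/eqP/eqP => [itE|->]; last exact/period_dvdP.
  have per : period (itin c) = period t.
    by rewrite -itE /period (order_iter (@shift_inj _ _)).
  by rewrite -itE; apply/esym/period_dvdP; rewrite per.
have ordf c : itin c = t -> (order c == period t) = (f c == c).
  move=> ct; apply/eqP/eqP => [oc|fc].
    by rewrite /f -oc permX iter_order //; exact: perm_inj.
  apply/eqP; rewrite eqn_dvd -{2}ct period_dvdn_order andbT.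
  by rewrite dvdn_order; [rewrite -permX; apply/eqP|exact: perm_inj].
have decr c c' : itin c = t -> itin c' = t -> (c < c')%N -> (f c' < f c)%N.
  move=> ct ct' lt_cc'; rewrite ltn_neqAle leqNgt ltn_expg ?ct ?ct' //.
  rewrite -/f (inj_eq val_inj) (inj_eq (@perm_inj _ f)) -[odd _]/(negative neg t).
  rewrite neg_t andbT.
  by rewrite -(inj_eq val_inj) eq_sym neq_ltn lt_cc'.
(* Cards moved down; the involution exchanges them with those moved up. *)
pose lower := (\sum_c ((itin c == t) && (f c < c)))%N.
have F2E : F2 = (lower + lower)%N.
  have -> : F2 = (lower + \sum_c ((itin c == t) && (c < f c)))%N.
    rewrite /F2 /lower -big_split; apply: eq_bigr => c _ /=.
    case: eqP => //= ct; have := ordf c ct.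
    rewrite -(inj_eq val_inj) /=; case: ltngtP => _; case: (ordP c ct) => [->|[_ ->]];
      by rewrite ?eqxx //; lia.
  congr (_ + _)%N; rewrite /lower [RHS](reindex_inj (@perm_inj _ f)).
  apply: eq_bigr => c _; rewrite itf; case: eqP => //= ct.
  suff -> : f (f c) = c by [].
  rewrite -permM -expgD addnn -mul2n; case: (ordP c ct) => [|[_]] ord_c.
    by rewrite mul2n -addnn expgD permM -ord_c !permX !iter_order //; exact: perm_inj.
  by rewrite -ord_c permX iter_order //; exact: perm_inj.
have leF1 : (F <= 1)%N.
  rewrite /F.
  case: (pickP (fun c => (itin c == t) && (order c == period t))) => [c|none].
    move=> /andP[/eqP ct oc]; rewrite (bigD1 c) //= ct eqxx oc big1 // => c' neq.
    apply/eqP; rewrite eqb0; apply/negP => /andP[/eqP ct' oc'].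
    move: oc oc'; rewrite !ordf // => /eqP fc /eqP fc'.
    have : val c' != val c by [].
    rewrite neq_ltn => /orP[lt|lt]; have := decr _ _ _ _ lt;
      rewrite fc fc' => /(_ _ _)/ltnW.
      by rewrite leqNgt lt => /(_ ct' ct).
    by rewrite leqNgt lt => /(_ ct ct').
  by rewrite big1 // => c _; rewrite none.
rewrite mul1n multE F2E; move: leF1; clear; case: F => [|[|//]] _; split; lia.
Qed.

Lemma mult_iter k t : mult (iter k (@shift _ _) t) = mult t.
Proof. by elim: k => //= k IHk; rewrite mult_shift. Qed.

Lemma sum_mult_orbits :
  (\sum_(r : cword T P' | froots (@shift _ _) r) period r * mult r)%N = n.
Proof.
rewrite -[RHS](sum_mult w s) (big_orbits (@shift_inj _ _)).
apply: eq_bigr => r _; rewrite (eq_bigr (fun=> mult r)) => [|h _]; last exact: mult_iter.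
by rewrite sum_nat_const card_ord.
Qed.

Lemma leq_period_mult r : froots (@shift _ _) r -> (period r * mult r <= n)%N.
Proof. by move=> rr; rewrite -[leqRHS]sum_mult_orbits (bigD1 r) //= leq_addr. Qed.

(** Counting cards instead of cycles multiplies both sides by i, and the
distribution of cycle lengths is the same for all sequences in an orbit. *)
Lemma ncycles_orbits i : (0 < i)%N ->
  ncycles i s = (\sum_(r : cword T P' | froots (@shift _ _) r)
    ((period r == i) * fixed_mult r +
     (2 * period r == i) * (negative neg r * (mult r)./2)))%N.
Proof.
move=> i_gt0; apply/eqP; rewrite -(eqn_pmul2l i_gt0) ncycles_order; apply/eqP.
transitivity (\sum_t \sum_c ((itin c == t) && (order c == i)))%N.
  rewrite exchange_big; apply: eq_bigr => c _ /=.
  rewrite (bigD1 (itin c)) //= eqxx big1 ?addn0 // => t.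
  by rewrite eq_sym => /negPf->.
rewrite (big_orbits (@shift_inj _ _)) big_distrr; apply: eq_bigr => r _ /=.
rewrite (eq_bigr (fun=> \sum_c ((itin c == r) && (order c == i)))%N) => [|h _].
  rewrite sum_nat_const card_ord count_order -/(period r) !mulnDr.
  by congr (_ + _)%N; case: eqP => [<-|_]; rewrite ?mul0n ?muln0 ?mul1n; lia.
elim: {h}(h : nat) => //= h <-.
rewrite (reindex_inj (@perm_inj _ s)); apply: eq_bigr => c _ /=.
by rewrite itinerary_perm (inj_eq (@shift_inj _ _)) (order_image (@perm_inj _ s)).
Qed.

Lemma cycle_product_orbits (V : comNzRingType) (x : nat -> V) :
  \prod_(1 <= i < n.+1) x i ^+ ncycles i s =
  \prod_(r : cword T P' | froots (@shift _ _) r)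
     (if negative neg r
      then x (period r) ^+ odd (mult r) * x (2 * period r)%N ^+ (mult r)./2
      else x (period r) ^+ mult r).
Proof.
transitivity (\prod_(1 <= i < n.+1) \prod_(r : cword T P' | froots (@shift _ _) r)
   (x i ^+ ((period r == i) * fixed_mult r)%N *
    x i ^+ ((2 * period r == i) * (negative neg r * (mult r)./2))%N)).
  rewrite big_nat [RHS]big_nat; apply: eq_bigr => i /andP[i_gt0 _].
  by rewrite ncycles_orbits // expr_sum; apply: eq_bigr => r _; rewrite exprD.
have pick d k : (0 < d)%N -> ((0 < k)%N -> (d <= n)%N) ->
    \prod_(1 <= i < n.+1) x i ^+ ((d == i) * k)%N = x d ^+ k.
  move=> d_gt0 le_dn; have [->|k_gt0] := posnP k.
    by rewrite big1 // => i _; rewrite muln0.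
  rewrite (bigD1_seq d) ?iota_uniq ?mem_index_iota ?d_gt0 ?ltnS ?le_dn //=.
  rewrite eqxx mul1n big1 ?mulr1 // => i.
  by rewrite eq_sym => /negPf->.
rewrite exchange_big; apply: eq_bigr => r rr.
have p_gt0 := period_gt0 r; have le_n := leq_period_mult rr.
rewrite big_split /= !pick ?muln_gt0 //; last first.
- move=> f_gt0; rewrite (leq_trans _ le_n) // leq_pmulr //.
  by move: f_gt0; rewrite /fixed_mult; case: ifP => // _; case: (mult r).
- move=> /andP[_ half_gt0]; rewrite (leq_trans _ le_n) //.
  rewrite [(2 * _)%N]mulnC leq_mul2l.
  by move: half_gt0; case: (mult r) => [|[|k]] // _; rewrite orbT.
by rewrite /fixed_mult; case: ifP; rewrite ?mul1n // mul0n mulr1.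
Qed.

Lemma weight_orbits (V : comNzRingType) (a : T -> V) :
  \prod_c a (w c) =
  \prod_(r : cword T P' | froots (@shift _ _) r) period_prod a r ^+ mult r.
Proof.
transitivity (\prod_t a (letter t 0) ^+ mult t).
  rewrite (reindex_inj (@perm_inj _ s)).
  rewrite (partition_big itin predT) //=; apply: eq_bigr => t _.
  rewrite (eq_bigr (fun=> a (letter t 0))) => [|c /eqP <-]; last first.
    by rewrite letter_itinerary expg1.
  by rewrite prodr_const -sum1_card big_mkcond.
rewrite (big_orbits (@shift_inj _ _)); apply: eq_bigr => r _.
by rewrite /period_prod -prodrXl; apply: eq_bigr => h _; rewrite mult_iter letter_iter.
Qed.

End CycleType.

(** * Summing over words *)

(** Expanding the product chooses a multiplicity [k i] from each factor.  The choice
[ord0] for the indices outside [P] makes [k] unique. *)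
Lemma coef_prod_dilate (R : numFieldType) (A : comAlgType R) (I : finType)
    (P : pred I) (d : I -> nat) (f : I -> fps A) n :
  (forall i, P i -> (0 < d i)%N) ->
  (\big[@fps_mul A/fps_one A]_(i | P i) dilate (d i) (f i)) n =
  \sum_(k : {ffun I -> 'I_n.+1} | [forall i, ~~ P i ==> (k i == ord0)] &&
                                  (\sum_(i | P i) d i * k i == n)%N)
     \prod_(i | P i) f i (k i).
Proof.
move=> d_gt0.
pose q i : {poly A} :=
  \sum_(k < n.+1) (if P i then f i k *: 'X^(d i * k) else (k == ord0)%:R).
have agree_q i : P i -> agree n.+1 (dilate (d i) (f i)) (q i).
  move=> Pi j ltj; rewrite /q Pi coef_sum /dilate.
  under eq_bigr do rewrite coefZ coefXn.
  case: ifP => [/dvdnP[l jE]|ndvd]; last first.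
    rewrite big1 // => k _; case: eqP => [jE|]; last by rewrite mulr0.
    by rewrite jE dvdn_mulr in ndvd.
  have ltl : (l < n.+1)%N by apply: leq_ltn_trans ltj; rewrite jE leq_pmulr ?d_gt0.
  rewrite (bigD1 (Ordinal ltl)) //= jE mulnK ?d_gt0 // mulnC eqxx mulr1.
  rewrite big1 ?addr0 // => k /negPf nk.
  rewrite eqn_pmul2l ?d_gt0 // eq_sym.
  by rewrite -[_ == _]/(k == Ordinal ltl) nk mulr0.
have agree_prod : agree n.+1 (\big[@fps_mul A/fps_one A]_(i | P i) dilate (d i) (f i))
    (\prod_(i | P i) q i).
  apply: (big_ind2 (fun g p => agree n.+1 g p)) => //.
    exact: agree_one.
  by move=> g p g' p'; exact: agree_mul.
rewrite -agree_prod //.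
have -> : \prod_(i | P i) q i = \prod_i q i.
  rewrite big_mkcond; apply: eq_bigr => i _; rewrite /q; case: (P i) => //.
  by rewrite (bigD1 ord0) //= big1 ?addr0 // => k /negPf->.
rewrite bigA_distr_bigA coef_sum [RHS]big_mkcond; apply: eq_bigr => k _ /=.
have [/forallP k0|] := boolP [forall i, ~~ P i ==> (k i == ord0)]; last first.
  rewrite negb_forall => /existsP[i]; rewrite negb_imply => /andP[nPi /negPf ki].
  by rewrite (bigD1 i) //= (negPf nPi) ki mul0r coef0.
have -> : \prod_i (if P i then f i (k i) *: 'X^(d i * k i) else (k i == ord0)%:R) =
    (\prod_(i | P i) f i (k i)) *: 'X^(\sum_(i | P i) d i * k i)%N.
  rewrite (eq_bigr (fun i => if P i then f i (k i) *: 'X^(d i * k i) else 1)) => [|i _].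
    by rewrite -big_mkcond /= scaler_prod expr_sum.
  by case: ifP => // nPi; move: (k0 i); rewrite nPi /= => ->.
by rewrite coefZ coefXn eq_sym /=; case: eqP; rewrite ?mulr1 ?mulr0.
Qed.

(** The orbit of [r], with the weight of a cycle the product of the weights of its
letters. *)
Definition orbit_series (T : finType) (neg : T -> bool) (P' : nat)
    (R : numFieldType) (A : comAlgType R) (a : T -> R) (x : nat -> A)
    (r : cword T P') : fps A :=
  dilate (period r)
    (orbit_factor (negative neg r) (period_prod a r *: x (period r))
       (period_prod a r ^+ 2 *: x (2 * period r)%N)).

Section WordSum.

Variables (T : finType) (rank : T -> nat) (neg : T -> bool).
Hypothesis rank_inj : injective rank.
Variables (n : nat) (st : {ffun 'I_n -> T} -> 'S_n).
Hypothesis stP : forall w, sorts rank neg w (st w).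
Variables (R : numFieldType) (A : comAlgType R) (a : T -> R) (x : nat -> A).
Local Notation P' := (n`!.-1).
Local Notation root := (froots (@shift T P')).

Lemma orbit_factor_scale (b : bool) (c : R) (y z : A) k :
  orbit_factor b (c *: y) (c ^+ 2 *: z) k =
  c ^+ k *: (if b then y ^+ odd k * z ^+ k./2 else y ^+ k).
Proof.
rewrite /orbit_factor; case: b; rewrite !exprZn //.
rewrite -scalerAl -scalerAr scalerA -exprM -exprD mul2n.
by rewrite odd_double_half.
Qed.

(** A word corresponds to the multiplicities of the roots of the shift orbits, which
can be any family of total size n; weight and cycle type are then products over
the orbits. *)
Lemma word_sum :
  \sum_(w : {ffun 'I_n -> T})
     (\prod_c a (w c)) *: \prod_(1 <= i < n.+1) x i ^+ ncycles i (st w) =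
  (\big[@fps_mul A/fps_one A]_(r : cword T P' | root r) orbit_series neg a x r) n.
Proof.
have symf := fconnect_sym (@shift_inj T P').
rewrite coef_prod_dilate => [|r _]; last exact: period_gt0.
pose mu w t := mult w (st w) t.
(* The multiplicities of the roots only, as they determine the others. *)
pose K w : {ffun cword T P' -> 'I_n.+1} :=
  [ffun t => if root t then inord (mu w t) else ord0].
have mu_lt w t : (mu w t < n.+1)%N.
  by rewrite ltnS -[leqRHS](sum_mult w (st w)) (bigD1 t) //= leq_addr.
have KE w t : root t -> K w t = mu w t :> nat.
  by move=> rt; rewrite ffunE rt inordK.
have mu_root w t : mu w t = mu w (froot (@shift _ _) t).
  have /iter_findex <- : fconnect (@shift _ _) t (froot (@shift _ _) t).
    exact: connect_root.
  by rewrite /mu mult_iter.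
have K_inj : injective K.
  move=> w w' /ffunP eqK; apply: (mult_inj (stP w) (stP w')) => t.
  rewrite -/(mu w t) -/(mu w' t) mu_root [RHS]mu_root -!KE ?eqK //; exact: roots_root.
rewrite (eq_bigl (mem [set K w | w in setT])) => [|k].
  rewrite big_imset /=; last by move=> w w' _ _; exact: K_inj.
  apply: eq_big => [w|w _]; first by rewrite inE.
  rewrite (cycle_product_orbits (stP w)) (weight_orbits w (st w)) -scaler_prod.
  by apply: eq_bigr => r rr; rewrite orbit_factor_scale KE.
rewrite [RHS]/=; apply/andP/imsetP => [[/forallP k0 /eqP sum_k]|[w _ ->]].
  (* The invariant multiset with the given multiplicities at the roots. *)
  pose M t : nat := k (froot (@shift _ _) t).
  have [||w wM] := mult_surj (M := M) rank_inj stP.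
  - move=> t; rewrite /M; congr (k _ : nat); apply/eqP.
    by rewrite root_connect // symf fconnect1.
  - rewrite (big_orbits (@shift_inj _ _)) -[RHS]sum_k; apply: eq_bigr => r rr.
    rewrite (eq_bigr (fun=> k r : nat)) => [|h _]; first by rewrite sum_nat_const card_ord.
    rewrite /M; congr (k _ : nat); rewrite -[RHS](eqP rr); apply/eqP.
    by rewrite root_connect // symf fconnect_iter.
  exists w => //; apply/ffunP => t; apply: val_inj; rewrite /=.
  have [rt|nrt] := boolP (root t); first by rewrite KE // /mu wM /M (eqP rt).
  by have := k0 t; rewrite nrt /= ffunE (negPf nrt) => /eqP->.
split; first by apply/forallP => t; apply/implyP => /negPf nrt; rewrite ffunE nrt.
rewrite -[X in _ == X](sum_mult_orbits w (st w)); apply/eqP.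
by apply: eq_bigr => r rr; rewrite KE.
Qed.

End WordSum.

(** * The shelf shuffle *)

Section Shelves.

Variables n m : nat.
Implicit Types (w : outcome n m) (l : 'I_m * bool).

Definition shelf_rank l : nat := (2 * l.1 + ~~ l.2)%N.

Definition shelf_neg l : bool := ~~ l.2.

Lemma shelf_rank_inj : injective shelf_rank.
Proof.
move=> [s b] [s' b']; rewrite /shelf_rank /= => eq_r.
have [eq_s ->] : val s = val s' /\ b = b' by case: b b' eq_r => [] [] /=; lia.
by rewrite (val_inj eq_s).
Qed.

(** Adding the cards in decreasing order: a card put on the top is smaller than the
ones already there, and so is a card put at the bottom. *)
Lemma dealE w s : deal w s =
  [seq c <- enum 'I_n | w c == (s, true)] ++
  rev [seq c <- enum 'I_n | w c == (s, false)].
Proof.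
rewrite /deal foldl_rev; elim: (enum 'I_n) => //= c l IHl.
rewrite /deal_card; case: (w c) => s' b /=; rewrite !xpair_eqE [s' == s]eq_sym.
by case: eqP => //= _; rewrite IHl; case: b => //=; rewrite rev_cons rcons_cat.
Qed.

Lemma count_deck w c : count_mem c (deck w) = 1%N.
Proof.
have count_pile s b :
    count_mem c [seq c <- enum 'I_n | w c == (s, b)] = (w c == (s, b)).
  rewrite count_uniq_mem; last by apply: filter_uniq; exact: enum_uniq.
  by rewrite mem_filter mem_enum andbT.
rewrite /deck count_flatten -map_comp sumnE big_map big_enum /=.
rewrite (bigD1 (w c).1) //= big1 ?addn0 => [|s];
  rewrite dealE count_cat count_rev !count_pile; case: (w c) => s' b /=.
  by rewrite !xpair_eqE eqxx; case: b.
by rewrite eq_sym => /negPf neq; rewrite !xpair_eqE neq.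
Qed.

Lemma deck_perm w : {s : 'S_n | deck w = [seq s i | i <- enum 'I_n]}.
Proof.
have eq_deck : perm_eq (deck w) (enum 'I_n).
  apply/allP => c _; apply/eqP; rewrite count_deck.
  by rewrite count_uniq_mem ?enum_uniq // mem_enum.
have size_deck : size (deck w) == n by rewrite (perm_size eq_deck) size_enum_ord.
pose t := Tuple size_deck.
have t_inj : injective (tnth t).
  by apply/tuple_uniqP; rewrite (perm_uniq eq_deck) enum_uniq.
by exists (perm t_inj); rewrite (eq_map (permE t_inj)) map_tnth_enum.
Qed.

Definition shelf_perm w : 'S_n := sval (deck_perm w).

Lemma deck_shelf_perm w (s : 'S_n) :
  (deck w == [seq s i | i <- enum 'I_n]) = (shelf_perm w == s).
Proof.
rewrite /shelf_perm; case: deck_perm => s' /= ->.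
apply/eqP/eqP => [eq_s|->//]; apply/permP => i.
by move/eq_in_map: eq_s; apply; rewrite mem_enum.
Qed.

Lemma sorts_shelf_perm w : sorts shelf_rank shelf_neg w (shelf_perm w).
Proof.
pose r (c c' : 'I_n) := (shelf_rank (w c) < shelf_rank (w c'))%N ||
  (w c == w c') && (shelf_neg (w c) (+) (c < c')%N).
have ord_pairwise k : pairwise (fun i j : 'I_k => (i < j)%N) (enum 'I_k).
  rewrite -(pairwise_map (fun i : 'I_k => i : nat) ltn) val_enum_ord.
  by rewrite -(sorted_pairwise ltn_trans) iota_ltn_sorted.
have deck_pairwise : pairwise r (deck w).
  rewrite /deck; elim: (enum 'I_m) (ord_pairwise m) => //= s ss IHss /andP[s_ss].
  move=> /IHss pss; rewrite pairwise_cat pss andbT; apply/andP; split.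
    apply/allrelP => c c' cs /flattenP[_ /mapP[s' s's' ->]] c's'.
    have shelf u x : x \in deal w u -> (w x).1 = u.
      by rewrite dealE mem_cat mem_rev !mem_filter => /orP[/andP[/eqP->]|/andP[/eqP->]].
    have := allP s_ss _ s's'; rewrite /= -(shelf _ _ cs) -(shelf _ _ c's') => lt_s.
    apply/orP; left; rewrite /shelf_rank.
    by case: (w c).2 (w c').2 => [] []; move: lt_s => /=; lia.
  rewrite dealE pairwise_cat; apply/and3P; split.
  - apply/allrelP => c c'; rewrite mem_rev !mem_filter.
    move=> /andP[/eqP wc _] /andP[/eqP wc' _].
    by rewrite /r wc wc' /shelf_rank /= addn0 addn1 ltnSn.
  - apply: (sub_in_pairwise (P := fun c => w c == (s, true))
              (r := fun c c' : 'I_n => (c < c')%N)).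
    + by move=> c c' /eqP wc /eqP wc' lt_c; rewrite /r wc wc' eqxx lt_c orbT.
    + exact: filter_all.
    exact: pairwise_filter (ord_pairwise n).
  apply: (sub_in_pairwise (P := fun c => w c == (s, false))
            (r := fun c c' : 'I_n => (c' < c)%N)).
  + move=> c c' /eqP wc /eqP wc' lt_c.
    by rewrite /r wc wc' eqxx /shelf_neg /= -leqNgt (ltnW lt_c) orbT.
  + by rewrite all_rev; exact: filter_all.
  have gt_trans : transitive (fun c c' : 'I_n => (c' < c)%N).
    by move=> c1 c2 c3 lt12 lt31; exact: ltn_trans lt31 lt12.
  have lt_trans : transitive (fun c c' : 'I_n => (c < c')%N).
    by move=> c1 c2 c3 lt12 lt31; exact: ltn_trans lt12 lt31.
  rewrite -sorted_pairwise // rev_sorted sorted_pairwise //.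
  exact: pairwise_filter (ord_pairwise n).
move=> i j lt_ij; rewrite -/(r _ _).
move: deck_pairwise; rewrite /shelf_perm; case: deck_perm => s /= ->.
rewrite pairwise_map => /(pairwiseP i) /(_ i j).
by rewrite !inE size_enum_ord !nth_ord_enum; apply.
Qed.

End Shelves.

Lemma cycle_genfun_words (R : realType) (m : nat) (p : R) n : (0 < n)%N ->
  cycle_genfun m p n =
  \sum_(w : outcome n m)
    (\prod_c (m%:R^-1 * (if (w c).2 then p else 1 - p))) *:
    \prod_(1 <= i < n.+1) xvar R i ^+ ncycles i (shelf_perm w).
Proof.
case: n => // n _; rewrite /cycle_genfun /= /nu.
transitivity (\sum_(s : 'S_n.+1)
    \sum_(w : outcome n.+1 m | deck w == [seq s i | i <- enum 'I_n.+1])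
       outcome_prob p w *: cycle_monomial R s).
  by apply: eq_bigr => s _; rewrite scaler_suml.
rewrite (exchange_big_dep xpredT) //=; apply: eq_bigr => w _.
rewrite (eq_bigl (fun s => s == shelf_perm w)) ?big_pred1_eq // => s.
by rewrite deck_shelf_perm eq_sym.
Qed.

(** * Comparing logarithmic derivatives *)

Section OrbitLogarithms.

Variables (T : finType) (neg : T -> bool) (P' : nat).
Variables (R : numFieldType) (A : comAlgType R) (a : T -> R) (x : nat -> A).
Implicit Types t : cword T P'.

Lemma negative_shift t : negative neg (shift t) = negative neg t.
Proof.
rewrite /negative period_shift.
by rewrite (big_period_shift _ (fun y => nat_of_bool (neg y))).
Qed.

(** The share of one sequence in the logarithmic derivative of the factor of its orbit,
so that sums over orbits become sums over all sequences. *)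
Definition cyclic_logder t : fps A :=
  dilate (period t)
    (orbit_logder (negative neg t) (period_prod a t *: x (period t))
       (period_prod a t ^+ 2 *: x (2 * period t)%N)).

Lemma logder_orbit_series t :
  logder (orbit_series neg a x t) (fun k => cyclic_logder t k *+ period t).
Proof. by apply: logder_dilate; [exact: period_gt0 | exact: logder_orbit]. Qed.

Lemma sum_cyclic_logder k :
  \sum_(r : cword T P' | froots (@shift _ _) r) cyclic_logder r k *+ period r =
  \sum_t cyclic_logder t k.
Proof.
rewrite (big_orbits (@shift_inj _ _)); apply: eq_bigr => r _.
rewrite (eq_bigr (fun=> cyclic_logder r k)) => [|h _]; last first.
  elim: {h}(h : nat) => //= h <-; rewrite /cyclic_logder.
  by rewrite period_shift negative_shift period_prod_shift.
by rewrite sumr_const card_ord.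
Qed.

Lemma orbit_logderE (b : bool) (c : R) (y z : A) r :
  orbit_logder b (c *: y) (c ^+ 2 *: z) r =
  (if r == 0%N then 0 else ((-1) ^+ (b * r.+1) * c ^+ r) *: y ^+ r) +
  dilate 2 (fun j => if j == 0%N then 0 else (c ^+ (2 * j) *+ (2 * b)) *: z ^+ j) r.
Proof.
rewrite /orbit_logder /dilate dvdn2; case: r => [|r]; first by rewrite addr0.
rewrite divn2; case: b; last first.
  rewrite mul0n muln0 expr0 mul1r exprZn /= mulr0n scale0r.
  by rewrite !if_same addr0.
rewrite -scaleNr mul1n !exprZn -scaleNr; congr (_ *: _ + _).
  by rewrite [in LHS]exprNn exprS mulN1r mulNr opprK !exprS !mulN1r opprK.
rewrite /= uphalf_half; case: (odd r) => //=.
by rewrite add1n /= scalerMnl -exprM.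
Qed.

Lemma eq_dilate d (f g : fps A) k : f =1 g -> dilate d f k = dilate d g k.
Proof. by move=> fg; rewrite /dilate fg. Qed.

Lemma dilateD d (f g : fps A) k :
  dilate d (fun j => f j + g j) k = dilate d f k + dilate d g k.
Proof. by rewrite /dilate; case: ifP; rewrite ?addr0. Qed.

Lemma dilate_dilate d e (f : fps A) k : (0 < d)%N ->
  dilate d (dilate e f) k = dilate (e * d) f k.
Proof.
move=> d_gt0; rewrite /dilate; have [dk|ndk] := boolP (d %| k)%N; last first.
  by case: ifP => // edk; rewrite (dvdn_trans (dvdn_mull e (dvdnn d)) edk) in ndk.
by rewrite -divnMA [(d * e)%N]mulnC dvdn_divRL.
Qed.

(** Sorted by the index i and the exponent r of the variable: a sequence of period d
involves the variable d and, if it is negative, the variable 2 d. *)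
Lemma cyclic_logderE N k t : (0 < k <= N)%N ->
  cyclic_logder t k =
  \sum_(1 <= i < N.+1) \sum_(1 <= r < k.+1) if (k == i * r)%N then
    ((if period t == i then (-1) ^+ (negative neg t * r.+1) * period_prod a t ^+ r
      else 0) +
     (if negative neg t && (2 * period t == i)%N then period_prod a t ^+ (2 * r) *+ 2
      else 0)) *: x i ^+ r else 0.
Proof.
move=> /andP[k_gt0 le_kN]; have p_gt0 := period_gt0 t.
have pick (d : nat) (G : nat -> nat -> A) : (0 < d)%N ->
    \sum_(1 <= i < N.+1) \sum_(1 <= r < k.+1)
       (if d == i then if (k == i * r)%N then G i r else 0 else 0) =
    \sum_(1 <= r < k.+1) if (k == d * r)%N then G d r else 0.
  move=> d_gt0; have [le_dN|lt_Nd] := leqP d N.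
    rewrite (bigD1_seq d) ?iota_uniq ?mem_index_iota ?d_gt0 //=.
    rewrite eqxx [X in _ + X]big1 ?addr0 // => i; rewrite eq_sym => /negPf di.
    by rewrite big1 // => r _; rewrite di.
  rewrite [RHS]big_nat [RHS]big1 => [|r /andP[r_gt0 _]]; last first.
    by case: eqP => // kE; move: le_kN; rewrite kE; nia.
  rewrite big_nat big1 // => i /andP[_ lt_iN].
  by rewrite big1 // => r _; case: eqP => // dE; move: lt_Nd lt_iN; lia.
rewrite /cyclic_logder.
rewrite (eq_dilate _ _ (orbit_logderE _ _ _ _)) dilateD dilate_dilate //.
rewrite !dilateE ?muln_gt0 //.
have pos r : (1 <= r < k.+1)%N -> (r == 0)%N = false by lia.
pose y i r := ((-1) ^+ (negative neg t * r.+1) * period_prod a t ^+ r) *: x i ^+ r.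
pose z i r := (period_prod a t ^+ (2 * r) *+ (2 * negative neg t)) *: x i ^+ r.
transitivity (\sum_(1 <= r < k.+1)
      (if (k == period t * r)%N then y (period t) r else 0) +
   \sum_(1 <= r < k.+1)
      (if (k == (2 * period t) * r)%N then z (2 * period t)%N r else 0)).
  by congr (_ + _); rewrite big_nat [RHS]big_nat; apply: eq_bigr => r /pos ->.
rewrite -!pick ?muln_gt0 // -big_split; apply: eq_bigr => i _.
rewrite -big_split; apply: eq_bigr => r _ /=.
rewrite /y /z; case: (k == _); rewrite ?if_same ?addr0 // scalerDl.
congr (_ + _); first by case: ifP; rewrite ?scale0r.
by case: (negative neg t); case: ifP; rewrite /= ?muln0 ?mulr0n ?scale0r.
Qed.

Lemma sum_cyclic_logderE N k : (0 < k <= N)%N ->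
  \sum_t cyclic_logder t k =
  \sum_(1 <= i < N.+1) \sum_(1 <= r < k.+1)
    if (k == i * r)%N then orbit_power_sum P' neg a i r *: x i ^+ r else 0.
Proof.
move=> kN; rewrite (eq_bigr _ (fun t _ => cyclic_logderE t kN)).
rewrite exchange_big; apply: eq_bigr => i _; rewrite exchange_big.
apply: eq_bigr => r _ /=; case: (k == _); last by rewrite big1.
by rewrite -scaler_suml big_split -!big_mkcond.
Qed.

End OrbitLogarithms.

Section ShelfWeights.

Variables (R : realType) (m : nat) (p : R).
Hypothesis m_gt0 : (0 < m)%N.

Definition shelf_weight (l : 'I_m * bool) : R :=
  m%:R^-1 * (if l.2 then p else 1 - p).

Lemma shelf_power_sum r :
  \sum_l (-1) ^+ (shelf_neg l * r.+1) * shelf_weight l ^+ r =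
  m%:R * m%:R^-1 ^+ r * (p ^+ r - (- (1 - p)) ^+ r).
Proof.
rewrite -(pair_bigA _ (fun s b =>
  (-1) ^+ (shelf_neg (s, b) * r.+1) * shelf_weight (s, b) ^+ r)) /=.
rewrite (eq_bigr (fun=> m%:R^-1 ^+ r * (p ^+ r - (- (1 - p)) ^+ r))) => [|s _].
  by rewrite sumr_const card_ord -[LHS]mulr_natl mulrA.
rewrite big_bool /shelf_neg /shelf_weight /= mul0n expr0 mul1r mul1n !exprMn.
by rewrite exprS [(- (1 - p)) ^+ r]exprNn; ring.
Qed.

(** The power sums are [shelf_power_sum], so this is Moebius inversion of
[power_sum_orbits]; a block of length n! accommodates all periods up to n. *)
Lemma orbit_power_sum_Bcoef n i r : (0 < i <= n)%N -> (0 < r)%N ->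
  orbit_power_sum (n`!.-1) (@shelf_neg m) shelf_weight i r = Bcoef m p i r.
Proof.
have m_neq0 : m%:R != 0 :> R by rewrite pnatr_eq0 -lt0n.
pose F i r : R := (\sum_l (-1) ^+ (shelf_neg l * r.+1) * shelf_weight l ^+ r) ^+ i.
move=> le_in r_gt0; have i_gt0 : (0 < i)%N by case/andP: le_in.
rewrite (@moebius_inversion _ F (orbit_power_sum _ _ _) n) //; last first.
  move=> j s /andP[j_gt0 le_jn] s_gt0; rewrite /F (@power_sum_orbits _ (n`!.-1)) //.
  by rewrite prednK ?fact_gt0 // dvdn_fact // j_gt0.
rewrite /Bcoef big_seq [RHS]big_seq; apply: eq_bigr => d.
rewrite -dvdn_divisors // => di; rewrite /F shelf_power_sum -[RHS]mulrA; congr (_ * _).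
rewrite !exprMn -exprM; congr (_ * _).
rewrite expfzDr // -exprnP exprVn; congr (_ * _).
by rewrite -exprnN mulnAC [(d * _)%N]mulnC divnK.
Qed.

End ShelfWeights.

Lemma log_factorE (R : realType) (m : nat) (p : R) i k : (0 < k)%N ->
  log_factor m p i k *+ k =
  \sum_(1 <= r < k.+1)
    if (k == i * r)%N then Bcoef m p i r *: xvar R i ^+ r else 0.
Proof.
move=> k_gt0; rewrite /log_factor /fps_sum -sumrMnl big_nat [RHS]big_nat.
apply: eq_bigr => r /andP[r_gt0 _]; rewrite /fps_mono.
case: eqP => [kE|]; last by rewrite mul0rn.
by rewrite -kE scalerMnl -mulr_natr divfK // pnatr_eq0 -lt0n.
Qed.

Theorem theorem2p1 (R : realType) (m : nat) (p : R)
    (hm : (1 <= m)%N) (hp : 0 < p < 1) :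
  fps_prod_eq (fun i => fps_exp (log_factor m p i)) (cycle_genfun m p).
Proof.
move=> n; exists n => N le_nN.
have log0 i : log_factor m p i 0%N = 0 by rewrite /log_factor /fps_sum big_nil.
have logderL := logder_prod (index_iota 1 N.+1)
  (fun i (_ : xpredT i) => logder_exp (log0 i)).
have [->|n_gt0] := posnP n; first by case: logderL => ->.
rewrite cycle_genfun_words //.
rewrite (word_sum (@shelf_rank_inj m) (@sorts_shelf_perm n m) (shelf_weight p) (xvar R)).
have logderR := logder_prod (index_enum (cword ('I_m * bool)%type n`!.-1))
  (fun r (_ : froots (@shift _ _) r) =>
     logder_orbit_series (@shelf_neg m) (shelf_weight p) (xvar R) r).
apply: (logder_inj logderL logderR) => k le_kn.
have [->|k_gt0] := posnP k.
  have [_ -> _] := logderR; have [_ -> _] := logderL.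
  by [].
rewrite sum_cyclic_logder.
rewrite (@sum_cyclic_logderE _ _ _ _ _ _ _ N) ?k_gt0 ?(leq_trans le_kn) //.
apply: eq_bigr => i _; rewrite (log_factorE _ _ _ k_gt0).
apply: eq_big_nat => r /andP[r_gt0 _]; case: (k =P _) => [kE|_]; last by [].
have i_gt0 : (0 < i)%N by move: k_gt0; rewrite kE muln_gt0 => /andP[].
have le_in : (0 < i <= n)%N.
  by rewrite i_gt0 (leq_trans _ le_kn) // kE leq_pmulr.
by rewrite (orbit_power_sum_Bcoef p hm le_in r_gt0).
Qed.
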